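(* Let $\mathcal{C}$ be a quasicategory equipped with a distinguished class of morphisms called cofibrations which contains all identity morphisms of $\mathcal{C}$, and let $K$ be a simplicial set. If $\mathcal{C}$ admits pushouts along cofibrations, then $\mathcal{C}^K$ admits pushouts along object-wise cofibrations, and these can be computed object-wise. More precisely, if $F_{po}\colon\mathcal{C}^{\mathcal{I}}_{co}\to\mathcal{C}^{\mathcal{J}}_{co,po}$ is any functorial choice of pushouts in $\mathcal{C}$ along cofibrations, then $$(F_{po})^K\colon(\mathcal{C}^{\mathcal{I}}_{co})^K\longrightarrow(\mathcal{C}^{\mathcal{J}}_{co,po})^K,\qquad \bigl(K\times\Delta[n]\xrightarrow{\,y\,}\mathcal{C}^{\mathcal{I}}_{co}\bigr)\longmapsto(F_{po}\circ y)$$ is a functorial choice of pushouts in $\mathcal{C}^K$ (along object-wise cofibrations).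
   Context: Identity morphisms are the degenerate 1-simplices. A simplicial subset is 0-full if a simplex belongs to it exactly when all its vertices do. $\mathcal{J}=\Delta[1]\times\Delta[1]$ is the nerve of the free-standing commutative square, and $\mathcal{I}\subseteq\mathcal{J}$ is the nerve of the subcategory determined by the top horizontal map and the left vertical map. $\mathcal{C}^{\mathcal{I}}_{co}$ is the 0-full sub quasicategory of $\mathcal{C}^{\mathcal{I}}$ on the diagrams $C_3\leftarrowtail C_1\to C_2$ whose left vertical map $C_1\to C_3$ is a cofibration; $\mathcal{C}^{\mathcal{J}}_{co}$ is the 0-full sub quasicategory of $\mathcal{C}^{\mathcal{J}}$ on the squares whose left vertical map is a cofibration; $\mathcal{C}^{\mathcal{J}}_{co,po}\subseteq\mathcal{C}^{\mathcal{J}}_{co}$ is 0-full on the pushout squares. ''$\mathcal{C}$ admits pushouts along cofibrations'' means that every diagram $C_3\leftarrowtail C_1\to C_2$ in $\mathcal{C}^{\mathcal{I}}_{co}$ extends to a pushout square. A functorial choice of pushouts in $\mathcal{C}$ along cofibrations is a map $F_{po}\colon\mathcal{C}^{\mathcal{I}}_{co}\to\mathcal{C}^{\mathcal{J}}_{co,po}$ that is a (strict) right inverse to the restriction $\mathrm{res}_{po}\colon\mathcal{C}^{\mathcal{J}}_{co,po}\to\mathcal{C}^{\mathcal{I}}_{co}$ along $\mathcal{I}\hookrightarrow\mathcal{J}$. In $\mathcal{C}^K$, a morphism $\beta\colon K\times\Delta[1]\to\mathcal{C}$ is an object-wise cofibration if for each vertex $k\in K_0$ the 1-simplex $\beta(k,-)$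 is a cofibration in $\mathcal{C}$; the same notation $(-)^{\mathcal{I}}_{co},(-)^{\mathcal{J}}_{co},(-)^{\mathcal{J}}_{co,po}$ and terminology is applied to $\mathcal{C}^K$ with the object-wise cofibrations. One uses the isomorphisms $(\mathcal{C}^{\mathcal{I}}_{co})^K\cong(\mathcal{C}^K)^{\mathcal{I}}_{co}$ and $(\mathcal{C}^{\mathcal{J}}_{co})^K\cong(\mathcal{C}^K)^{\mathcal{J}}_{co}$, and $(\mathcal{C}^{\mathcal{J}}_{co,po})^K$ is regarded inside $(\mathcal{C}^K)^{\mathcal{J}}_{co}$. *)

(* Defs.v *)
From mathcomp Require Import all_boot.
From mathcomp Require Import boolp.

Set Implicit Arguments.
Unset Strict Implicit.
Unset Printing Implicit Defensive.
Set Primitive Projections.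

(* A morphism [m] -> [n] of the simplex category; [m] = {0,...,m} is 'I_m.+1.
   Primitive projections make the category laws hold by conversion. *)
Record mono (m n : nat) := Mono {
  mono_fun :> 'I_m.+1 -> 'I_n.+1;
  mono_leq : forall i j : 'I_m.+1, i <= j -> mono_fun i <= mono_fun j }.

Definition idm n : mono n n := Mono (mono_fun := fun i => i) (fun _ _ h => h).

Definition compm k m n (g : mono m n) (f : mono k m) : mono k n :=
  Mono (mono_fun := fun i => g (f i))
       (fun i j h => mono_leq g (mono_leq f h)).

Definition constm m n (i : 'I_n.+1) : mono m n :=
  Mono (mono_fun := fun _ => i) (fun _ _ _ => leqnn i).

Lemma monoP m n (f g : mono m n) : (forall i, f i = g i) -> f = g.
Proof.
case: f g => [f hf] [g hg] /= /funext fg.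
by case: g / fg hg => hg; rewrite (Prop_irrelevance hf hg).
Qed.

Record sset := SSet {
  simp :> nat -> Type;
  act : forall m n, mono m n -> simp n -> simp m;
  act_id : forall n (x : simp n), act (idm n) x = x;
  act_comp : forall k m n (g : mono m n) (f : mono k m) (x : simp n),
    act (compm g f) x = act f (act g x) }.

Record smap (X Y : sset) := SMap {
  sfun :> forall n, X n -> Y n;
  smap_nat : forall m n (f : mono m n) (x : X n),
    sfun (act f x) = act f (sfun x) }.

Lemma smapP (X Y : sset) (u v : smap X Y) :
  (forall n (x : X n), u n x = v n x) -> u = v.
Proof.
case: u v => [u hu] [v hv] /= uv.
have {}uv : u = v.
  by apply: functional_extensionality_dep => n; apply: funext => x; exact: uv.
by case: v / uv hv => hv; rewrite (Prop_irrelevance hu hv).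
Qed.

Definition smap_id (X : sset) : smap X X :=
  SMap (sfun := fun _ x => x) (fun _ _ _ _ => erefl).

Lemma smap_comp_nat (X Y Z : sset) (v : smap Y Z) (u : smap X Y) m n
  (f : mono m n) (x : X n) : v m (u m (act f x)) = act f (v n (u n x)).
Proof. by rewrite !smap_nat. Qed.

Definition smap_comp (X Y Z : sset) (v : smap Y Z) (u : smap X Y) : smap X Z :=
  SMap (smap_comp_nat v u).

Record subsset (X : sset) := SubSSet {
  smem :> forall n, X n -> Prop;
  smem_act : forall m n (f : mono m n) (x : X n), smem x -> smem (act f x) }.

Lemma sub_act_id (X : sset) (A : subsset X) n (x : {x : X n | A n x}) :
  exist (A n) (act (idm n) (sval x)) (smem_act (idm n) (proj2_sig x)) = x.
Proof. by case: x => x Ax; apply: eq_exist; rewrite /= act_id. Qed.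

Lemma sub_act_comp (X : sset) (A : subsset X) k m n (g : mono m n)
  (f : mono k m) (x : {x : X n | A n x}) :
  exist (A k) (act (compm g f) (sval x)) (smem_act (compm g f) (proj2_sig x)) =
  exist (A k) (act f (act g (sval x)))
        (smem_act f (smem_act g (proj2_sig x))).
Proof. by apply: eq_exist; rewrite act_comp. Qed.

Definition ssub (X : sset) (A : subsset X) : sset :=
  @SSet (fun n => {x : X n | A n x})
    (fun m n f x => exist _ (act f (sval x)) (smem_act f (proj2_sig x)))
    (@sub_act_id X A) (@sub_act_comp X A).

Definition sincl (X : sset) (A : subsset X) : smap (ssub A) X :=
  @SMap (ssub A) X (fun n x => sval x) (fun _ _ _ _ => erefl).

Lemma slift_nat (X Y : sset) (B : subsset Y) (u : smap X Y)
  (uB : forall n (x : X n), B n (u n x)) m n (f : mono m n) (x : X n) :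
  exist (B m) (u m (act f x)) (uB m (act f x)) =
  @act (ssub B) _ _ f (exist (B n) (u n x) (uB n x)).
Proof. by apply: eq_exist; rewrite /= smap_nat. Qed.

Definition slift (X Y : sset) (B : subsset Y) (u : smap X Y)
  (uB : forall n (x : X n), B n (u n x)) : smap X (ssub B) :=
  @SMap X (ssub B) (fun n x => exist _ (u n x) (uB n x)) (slift_nat uB).

Lemma full_act (X : sset) (P : X 0 -> Prop) m n (f : mono m n) (x : X n) :
  (forall v : mono 0 n, P (act v x)) ->
  forall v : mono 0 m, P (act v (act f x)).
Proof. by move=> Px v; rewrite -act_comp. Qed.

(* 0-full simplicial subset: a simplex belongs iff all its vertices satisfy P *)
Definition full (X : sset) (P : X 0 -> Prop) : subsset X :=
  @SubSSet X (fun n x => forall v : mono 0 n, P (act v x)) (@full_act X P).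

Definition Delta (n : nat) : sset :=
  @SSet (fun m => mono m n) (fun _ _ f x => compm x f)
    (fun _ _ => erefl) (fun _ _ _ _ _ _ => erefl).

Definition Delta_map m n (t : mono m n) : smap (Delta m) (Delta n) :=
  @SMap (Delta m) (Delta n) (fun _ x => compm t x) (fun _ _ _ _ => erefl).

Lemma boundary_act n m k (f : mono m k) (x : Delta n k) :
  (exists j, forall i, x i != j) -> exists j, forall i, act f x i != j.
Proof. by case=> j xj; exists j => i; exact: xj. Qed.

Definition boundary (n : nat) : subsset (Delta n) :=
  @SubSSet (Delta n)
    (fun m x => exists j : 'I_n.+1, forall i, (x : mono m n) i != j)
    (@boundary_act n).

Lemma horn_act n (k : 'I_n.+1) m l (f : mono m l) (x : Delta n l) :
  (exists j, j != k /\ forall i, x i != j) ->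
  exists j, j != k /\ forall i, act f x i != j.
Proof. by case=> j [jk xj]; exists j; split=> // i; exact: xj. Qed.

Definition horn (n : nat) (k : 'I_n.+1) : subsset (Delta n) :=
  @SubSSet (Delta n)
    (fun m x =>
       exists j : 'I_n.+1, j != k /\ forall i, (x : mono m n) i != j)
    (@horn_act n k).

Definition quasicategory (C : sset) : Prop :=
  forall (n : nat) (k : 'I_n.+1), 0 < k < n ->
  forall h : smap (ssub (horn k)) C,
  exists s : smap (Delta n) C, smap_comp s (sincl (horn k)) = h.

Definition identity (C : sset) (x : C 0) : C 1 := act (constm 1 ord0) x.

Lemma prod_act_id (X Y : sset) n (x : X n * Y n) :
  (act (idm n) x.1, act (idm n) x.2) = x.
Proof. by case: x => x y; rewrite !act_id. Qed.

Lemma prod_act_comp (X Y : sset) k m n (g : mono m n) (f : mono k m)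
  (x : X n * Y n) :
  (act (compm g f) x.1, act (compm g f) x.2) =
  (act f (act g x.1), act f (act g x.2)).
Proof. by rewrite !act_comp. Qed.

Definition sprod (X Y : sset) : sset :=
  @SSet (fun n => (X n * Y n)%type) (fun _ _ f x => (act f x.1, act f x.2))
    (@prod_act_id X Y) (@prod_act_comp X Y).

Definition sfst (X Y : sset) : smap (sprod X Y) X :=
  @SMap (sprod X Y) X (fun _ x => x.1) (fun _ _ _ _ => erefl).

Definition ssnd (X Y : sset) : smap (sprod X Y) Y :=
  @SMap (sprod X Y) Y (fun _ x => x.2) (fun _ _ _ _ => erefl).

Lemma spair_nat (X Y Z : sset) (u : smap Z X) (v : smap Z Y) m n
  (f : mono m n) (z : Z n) :
  (u m (act f z), v m (act f z)) = @act (sprod X Y) _ _ f (u n z, v n z).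
Proof. by rewrite !smap_nat. Qed.

Definition spair (X Y Z : sset) (u : smap Z X) (v : smap Z Y) :
  smap Z (sprod X Y) :=
  @SMap Z (sprod X Y) (fun n z => (u n z, v n z)) (spair_nat u v).

Definition sprod_map (X X' Y Y' : sset) (u : smap X X') (v : smap Y Y') :
  smap (sprod X Y) (sprod X' Y') :=
  spair (smap_comp u (sfst X Y)) (smap_comp v (ssnd X Y)).

Definition exp_act (K C : sset) m n (t : mono m n)
  (y : smap (sprod K (Delta n)) C) : smap (sprod K (Delta m)) C :=
  smap_comp y (sprod_map (smap_id K) (Delta_map t)).

Lemma exp_act_id (K C : sset) n (y : smap (sprod K (Delta n)) C) :
  exp_act (idm n) y = y.
Proof. by apply: smapP => m [k t]. Qed.

Lemma exp_act_comp (K C : sset) k m n (g : mono m n) (f : mono k m)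
  (y : smap (sprod K (Delta n)) C) :
  exp_act (compm g f) y = exp_act f (exp_act g y).
Proof. by apply: smapP => l [x t]. Qed.

(* The exponential C^K: its n-simplices are the maps K x Delta[n] -> C. *)
Definition sexp (K C : sset) : sset :=
  @SSet (fun n => smap (sprod K (Delta n)) C) (@exp_act K C)
    (@exp_act_id K C) (@exp_act_comp K C).

Lemma sexp_post_nat (K C D : sset) (F : smap C D) m n (t : mono m n)
  (y : sexp K C n) : smap_comp F (act t y) = act t (smap_comp F y : sexp K D n).
Proof. exact: smapP. Qed.

Definition sexp_post (K C D : sset) (F : smap C D) :
  smap (sexp K C) (sexp K D) :=
  @SMap (sexp K C) (sexp K D) (fun _ y => smap_comp F y) (sexp_post_nat F).

Lemma sexp_pre_nat (A B C : sset) (u : smap A B) m n (t : mono m n)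
  (y : sexp B C n) :
  smap_comp (act t y) (sprod_map u (smap_id (Delta m))) =
  act t (smap_comp y (sprod_map u (smap_id (Delta n))) : sexp A C n).
Proof. by apply: smapP => l []. Qed.

Definition sexp_pre (A B C : sset) (u : smap A B) :
  smap (sexp B C) (sexp A C) :=
  @SMap (sexp B C) (sexp A C)
    (fun n y => smap_comp y (sprod_map u (smap_id (Delta n))))
    (@sexp_pre_nat A B C u).

(* A vertex A x Delta[0] -> C of C^A, seen as a map A -> C *)
Lemma vertex_map_nat (A C : sset) (d : sexp A C 0) m n (f : mono m n)
  (a : A n) :
  d m (act f a, constm m ord0) = act f (d n (a, constm n ord0)).
Proof. by rewrite -smap_nat. Qed.

Definition vertex_map (A C : sset) (d : sexp A C 0) : smap A C :=
  @SMap A C (fun n a => d n (a, constm n ord0)) (vertex_map_nat d).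

(* The isomorphism (C^A)^K = (C^K)^A exchanging the two exponents *)
Section Swap.
Variables (K A C : sset).

Lemma swap2_nat n (y : sexp K (sexp A C) n) m (a : A m) (t : mono m n)
  k l (f : mono k l) (x : sprod K (Delta m) l) :
  (y k ((act f x).1, compm t (act f x).2)) k (act (act f x).2 a, idm k) =
  act f ((y l (x.1, compm t x.2)) l (act x.2 a, idm l)).
Proof.
rewrite -[RHS]smap_nat.
have -> : (act f x).1 = act f x.1 by [].
have -> : compm t (act f x).2 = act f (compm t x.2 : Delta n l) by [].
rewrite (smap_nat y f (x.1, compm t x.2 : Delta n l)) /=.
by rewrite -act_comp.
Qed.

Definition swap2 n (y : sexp K (sexp A C) n) m (x : sprod A (Delta n) m) :
  sexp K C m :=
  @SMap (sprod K (Delta m)) C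
    (fun l z => (y l (z.1, compm x.2 z.2)) l (act z.2 x.1, idm l))
    (@swap2_nat n y m x.1 x.2).

Lemma swap1_nat n (y : sexp K (sexp A C) n) m l (f : mono m l)
  (x : sprod A (Delta n) l) : swap2 y (act f x) = act f (swap2 y x).
Proof. by apply: smapP => k [z g] /=; rewrite -act_comp. Qed.

Definition swap1 n (y : sexp K (sexp A C) n) : sexp A (sexp K C) n :=
  @SMap (sprod A (Delta n)) (sexp K C) (@swap2 n y) (@swap1_nat n y).

Lemma swap_nat m n (f : mono m n) (y : sexp K (sexp A C) n) :
  swap1 (act f y) = act f (swap1 y).
Proof. by apply: smapP => l [a t]; apply: smapP. Qed.

Definition swap : smap (sexp K (sexp A C)) (sexp A (sexp K C)) :=
  SMap swap_nat.

End Swap.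

Lemma swapK (K A C : sset) :
  smap_comp (swap A K C) (swap K A C) = smap_id _.
Proof.
apply: smapP => n y; apply: smapP => m [k t]; apply: smapP => l [a f] /=.
have := smap_nat y f (k, t : Delta n m) => /= ->.
by rewrite /= act_id.
Qed.

(* The fibre of Delta[n] over the vertex e of Delta[1]: it is the simplex
   spanned by the i with phi i = e, or is empty if there is no such i. *)
Lemma fibre_act n (phi : mono n 1) (e : 'I_2) k m (f : mono k m)
  (x : Delta n m) :
  (forall i, phi (x i) = e) -> forall i, phi (act f x i) = e.
Proof. by move=> xe i; exact: xe. Qed.

Definition fibre n (phi : mono n 1) (e : 'I_2) : subsset (Delta n) :=
  @SubSSet (Delta n) (fun m x => forall i, phi ((x : mono m n) i) = e)
    (@fibre_act n phi e).

Lemma fibre_map_nat m n (t : mono m n) (phi : mono n 1) (e : 'I_2) k l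
  (f : mono k l) (x : ssub (fibre (compm phi t) e) l) :
  exist (fibre phi e k) (compm t (sval (act f x))) (proj2_sig (act f x)) =
  @act (ssub (fibre phi e)) _ _ f
    (exist (fibre phi e l) (compm t (sval x)) (proj2_sig x)).
Proof. exact: eq_exist. Qed.

Definition fibre_map m n (t : mono m n) (phi : mono n 1) (e : 'I_2) :
  smap (ssub (fibre (compm phi t) e)) (ssub (fibre phi e)) :=
  @SMap (ssub (fibre (compm phi t) e)) (ssub (fibre phi e))
    (fun k x => exist (fibre phi e k) (compm t (sval x)) (proj2_sig x))
    (@fibre_map_nat m n t phi e).

(* An n-simplex of the join of X and Y is a cut [n] = I + I' with I < I'
   (I = phi^-1(0), I' = phi^-1(1)), a simplex of X of shape I and a simplex of
   Y of shape I', there being exactly one simplex of empty shape.  A simplex of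
   X of shape I is given, by Yoneda, as a map to X from the simplex
   spanned by I. *)
Record join_simp (X Y : sset) (n : nat) := JoinSimp {
  jcut : mono n 1;
  jleft : smap (ssub (fibre jcut ord0)) X;
  jright : smap (ssub (fibre jcut ord_max)) Y }.

Definition join_act (X Y : sset) m n (t : mono m n) (s : join_simp X Y n) :
  join_simp X Y m :=
  @JoinSimp X Y m (compm (jcut s) t)
    (smap_comp (jleft s) (fibre_map t (jcut s) ord0))
    (smap_comp (jright s) (fibre_map t (jcut s) ord_max)).

Lemma join_eq (X Y : sset) n (phi : mono n 1)
  (l l' : smap (ssub (fibre phi ord0)) X)
  (r r' : smap (ssub (fibre phi ord_max)) Y) :
  (forall m x, l m x = l' m x) -> (forall m x, r m x = r' m x) ->
  JoinSimp l r = JoinSimp l' r'.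
Proof. by move=> /smapP -> /smapP ->. Qed.

Lemma join_act_id (X Y : sset) n (s : join_simp X Y n) :
  join_act (idm n) s = s.
Proof.
by case: s => phi l r; apply: join_eq => m [x h].
Qed.

Lemma join_act_comp (X Y : sset) k m n (g : mono m n) (f : mono k m)
  (s : join_simp X Y n) : join_act (compm g f) s = join_act f (join_act g s).
Proof. by case: s => phi l r; apply: join_eq => l' [x h]. Qed.

Definition sjoin (X Y : sset) : sset :=
  @SSet (join_simp X Y) (@join_act X Y) (@join_act_id X Y)
    (@join_act_comp X Y).

Lemma sjoin_map_nat (X X' Y Y' : sset) (u : smap X X') (v : smap Y Y') m n
  (t : mono m n) (s : sjoin X Y n) :
  @JoinSimp X' Y' m (jcut (act t s)) (smap_comp u (jleft (act t s)))
    (smap_comp v (jright (act t s))) =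
  @act (sjoin X' Y') _ _ t
    (@JoinSimp X' Y' n (jcut s) (smap_comp u (jleft s))
       (smap_comp v (jright s))).
Proof. by apply: join_eq. Qed.

Definition sjoin_map (X X' Y Y' : sset) (u : smap X X') (v : smap Y Y') :
  smap (sjoin X Y) (sjoin X' Y') :=
  @SMap (sjoin X Y) (sjoin X' Y')
    (fun n s => @JoinSimp X' Y' n (jcut s) (smap_comp u (jleft s))
                  (smap_comp v (jright s)))
    (@sjoin_map_nat X X' Y Y' u v).

Definition yoneda_fibre (X : sset) n (x : X n) (phi : mono n 1) (e : 'I_2) :
  smap (ssub (fibre phi e)) X :=
  @SMap (ssub (fibre phi e)) X (fun m f => act (sval f) x)
    (fun _ _ g f => act_comp (sval f) g x).

Lemma fibre0_empty n m (f : ssub (fibre (constm n ord0) ord_max) m) : False.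
Proof. by have := proj2_sig f ord0. Qed.

Definition empty_fibre (Y : sset) n :
  smap (ssub (fibre (constm n ord0) ord_max)) Y :=
  @SMap (ssub (fibre (constm n ord0) ord_max)) Y
    (fun m f => match fibre0_empty f with end)
    (fun _ _ _ f => match fibre0_empty f with end).

Lemma join_inl_nat (X Y : sset) m n (t : mono m n) (x : X n) :
  @JoinSimp X Y m (constm m ord0) (yoneda_fibre (act t x) _ _)
    (empty_fibre Y m) =
  @act (sjoin X Y) _ _ t
    (@JoinSimp X Y n (constm n ord0) (yoneda_fibre x _ _) (empty_fibre Y n)).
Proof.
apply: join_eq => k f /=; first by rewrite -act_comp.
by case: (fibre0_empty f).
Qed.

Definition join_inl (X Y : sset) : smap X (sjoin X Y) :=
  @SMap X (sjoin X Y)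
    (fun n x => @JoinSimp X Y n (constm n ord0) (yoneda_fibre x _ _)
                  (empty_fibre Y n))
    (@join_inl_nat X Y).

(* The slice C_{p/} under p : X -> C: its n-simplices are the maps
   X * Delta[n] -> C extending p. *)
Section Slice.
Variables (X C : sset) (p : smap X C).

Definition slice_simp n :=
  {f : smap (sjoin X (Delta n)) C | smap_comp f (join_inl X (Delta n)) = p}.

Lemma slice_actP m n (t : mono m n) (f : slice_simp n) :
  smap_comp
    (smap_comp (sval f) (sjoin_map (smap_id X) (Delta_map t)))
    (join_inl X (Delta m)) = p.
Proof.
rewrite -[RHS](proj2_sig f); apply: smapP => k x /=; congr (sval f k _).
by apply: join_eq => // l g; case: (fibre0_empty g).
Qed.

Definition slice_act m n (t : mono m n) (f : slice_simp n) : slice_simp m :=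
  exist _ _ (slice_actP t f).

Lemma slice_act_id n (f : slice_simp n) : slice_act (idm n) f = f.
Proof.
case: f => f fp; apply: eq_exist; apply: smapP => k s /=; congr (f k _).
by case: s => phi l r; apply: join_eq.
Qed.

Lemma slice_act_comp k m n (g : mono m n) (h : mono k m) (f : slice_simp n) :
  slice_act (compm g h) f = slice_act h (slice_act g f).
Proof.
apply: eq_exist; apply: smapP => l s /=; congr (sval f l _).
by case: s => phi u v; apply: join_eq.
Qed.

Definition slice : sset :=
  @SSet slice_simp slice_act slice_act_id slice_act_comp.

End Slice.

Lemma bd_vertex0P n : boundary n.+1 0 (constm 0 ord0).
Proof. by exists ord_max. Qed.

Definition bd_vertex0 n : ssub (boundary n.+1) 0 :=
  exist (boundary n.+1 0) (constm 0 ord0) (bd_vertex0P n).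

(* Joyal: every sphere in X of dimension > 0 whose 0-th vertex is a can be
   filled. *)
Definition initial (X : sset) (a : X 0) : Prop :=
  forall (n : nat) (s : smap (ssub (boundary n.+1)) X),
    s 0 (bd_vertex0 n) = a ->
  exists t : smap (Delta n.+1) X, smap_comp t (sincl (boundary n.+1)) = s.

(* The square Delta[1] x Delta[1]; the first coordinate is horizontal and the
   second one vertical, so that C1, C2, C3, C4 sit at (0,0), (1,0), (0,1),
   (1,1). *)
Definition Jsq : sset := sprod (Delta 1) (Delta 1).

Lemma Ispan_act m n (f : mono m n) (x : Jsq n) :
  (forall i, x.2 i = ord0) \/ (forall i, x.1 i = ord0) ->
  (forall i, (act f x).2 i = ord0) \/ (forall i, (act f x).1 i = ord0).
Proof. by case=> h; [left | right] => i; exact: h. Qed.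

(* The nerve of the subcategory determined by the top horizontal map
   (second coordinate 0) and the left vertical map (first coordinate 0) *)
Definition Ispan : subsset Jsq :=
  @SubSSet Jsq
    (fun n x => (forall i, (x.2 : mono n 1) i = ord0) \/
                (forall i, (x.1 : mono n 1) i = ord0)) Ispan_act.

Definition Isp : sset := ssub Ispan.

Definition res_incl : smap Isp Jsq := sincl Ispan.

Definition left_edgeJ : Jsq 1 := (constm 1 ord0, idm 1).

Lemma left_edgeP : Ispan 1 left_edgeJ.
Proof. by right. Qed.

Definition left_edgeI : Isp 1 := exist (Ispan 1) left_edgeJ left_edgeP.

(* The extension X * Delta[0] -> Delta[1] of u : X -> Delta[1] sending the
   cone point to 1 *)
Section ConeExt.
Variables (X : sset) (u : smap X (Delta 1)).

Definition fibre_vertex n (phi : mono n 1) e (i : 'I_n.+1) (ie : phi i = e) :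
  ssub (fibre phi e) 0 :=
  exist (fibre phi e 0) (constm 0 i) (fun _ => ie).

Definition cone_ext_fun n (s : sjoin X (Delta 0) n) (i : 'I_n.+1) : 'I_2 :=
  match jcut s i =P ord0 with
  | ReflectT ie => (u 0 (jleft s 0 (fibre_vertex ie)) : mono 0 1) ord0
  | ReflectF _ => ord_max
  end.

Lemma cone_ext_fun0 n (s : sjoin X (Delta 0) n) i (ie : jcut s i = ord0) :
  cone_ext_fun s i = (u 0 (jleft s 0 (fibre_vertex ie)) : mono 0 1) ord0.
Proof.
rewrite /cone_ext_fun; case: eqP => [ie'|//].
by rewrite (Prop_irrelevance ie ie').
Qed.

Lemma cone_ext_fun1 n (s : sjoin X (Delta 0) n) i :
  jcut s i <> ord0 -> cone_ext_fun s i = ord_max.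
Proof. by rewrite /cone_ext_fun; case: eqP. Qed.

Lemma cone_ext_simplex n (s : sjoin X (Delta 0) n) m
  (x : ssub (fibre (jcut s) ord0) m) (j : 'I_m.+1) :
  cone_ext_fun s ((sval x : mono m n) j) = (u m (jleft s m x) : mono m 1) j.
Proof.
rewrite (cone_ext_fun0 (proj2_sig x j)).
have -> : fibre_vertex (proj2_sig x j) = act (constm 0 j) x.
  by apply: eq_exist; exact: monoP.
by rewrite !smap_nat.
Qed.

Lemma cone_ext_leq n (s : sjoin X (Delta 0) n) (i j : 'I_n.+1) :
  i <= j -> cone_ext_fun s i <= cone_ext_fun s j.
Proof.
move=> ij; case: (jcut s j =P ord0) => [je|/cone_ext_fun1 ->]; last first.
  by rewrite -ltnS.
pose e (k : 'I_2) := if k == ord0 then i else j.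
have e_leq (k l : 'I_2) : k <= l -> e k <= e l.
  rewrite /e; case: eqP => [_|k0]; case: eqP => [->|_] //.
  by move=> k_le0; case: k0; apply/val_inj/eqP; rewrite -leqn0.
have ee (k : 'I_2) : jcut s (e k) = ord0.
  apply: val_inj; apply/eqP; rewrite -leqn0.
  have : jcut s (e k) <= jcut s j by apply: mono_leq; rewrite /e; case: ifP.
  by rewrite je.
pose x : ssub (fibre (jcut s) ord0) 1 :=
  exist (fibre (jcut s) ord0 1) (Mono e_leq) ee.
have := cone_ext_simplex x ord0; have := cone_ext_simplex x ord_max.
by rewrite /= {1 2}/e /= => -> ->; apply: mono_leq.
Qed.

Definition cone_ext_mono n (s : sjoin X (Delta 0) n) : Delta 1 n :=
  Mono (@cone_ext_leq n s).

Lemma cone_ext_nat m n (t : mono m n) (s : sjoin X (Delta 0) n) :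
  cone_ext_mono (act t s) = act t (cone_ext_mono s).
Proof.
apply: monoP => i /=; case: (jcut s (t i) =P ord0) => [ie|ie].
  rewrite (@cone_ext_fun0 _ (act t s) i ie) (cone_ext_fun0 ie) /=.
  congr (mono_fun (u 0 (jleft s 0 _)) _).
  by apply: eq_exist; exact: monoP.
by rewrite (@cone_ext_fun1 _ (act t s) i ie) (cone_ext_fun1 ie).
Qed.

Definition cone_ext : smap (sjoin X (Delta 0)) (Delta 1) :=
  SMap cone_ext_nat.

Lemma cone_ext_inl : smap_comp cone_ext (join_inl X (Delta 0)) = u.
Proof.
apply: smapP => n x; apply: monoP => i /=.
by rewrite (@cone_ext_fun0 _ (join_inl X (Delta 0) n x) i erefl) /= smap_nat.
Qed.

End ConeExt.

(* An isomorphism I * Delta[0] -> J (cone_to_sq_bij), sending the cone point to C4 = (1,1) *)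
Definition cone_to_sq : smap (sjoin Isp (Delta 0)) Jsq :=
  spair (cone_ext (smap_comp (sfst _ _) res_incl))
        (cone_ext (smap_comp (ssnd _ _) res_incl)).

Lemma join_ext (X Y : sset) n (s s' : sjoin X Y n) :
  jcut s = jcut s' ->
  (forall m (x : mono m n) h h',
     jleft s m (exist _ x h) = jleft s' m (exist _ x h')) ->
  (forall m (x : mono m n) h h',
     jright s m (exist _ x h) = jright s' m (exist _ x h')) -> s = s'.
Proof.
case: s s' => phi l r [phi' l' r'] /= E; case: phi' / E l' r' => l' r' El Er.
by apply: join_eq => m [x h]; [exact: El | exact: Er].
Qed.

Lemma ord2P (i : 'I_2) : i <> ord0 -> i = ord_max.
Proof. by case: i => [[|[|//]]] ? // h; [case: h|]; apply: val_inj. Qed.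

Section ConeInverse.
Variables (n : nat) (x : Jsq n).

Definition sq_cut_fun (i : 'I_n.+1) : 'I_2 :=
  if (x.1 i == ord_max) && (x.2 i == ord_max) then ord_max else ord0.

Lemma sq_cut_leq (i j : 'I_n.+1) : i <= j -> sq_cut_fun i <= sq_cut_fun j.
Proof.
move=> ij; rewrite /sq_cut_fun; case: ifP => // /andP [/eqP h1 /eqP h2].
have top (f : mono n 1) : f i = ord_max -> f j == ord_max.
  move=> fi; apply/eqP/ord2P => fj.
  by have := mono_leq f ij; rewrite fi fj.
by rewrite !top.
Qed.

Definition sq_cut : mono n 1 := Mono sq_cut_leq.

Lemma sq_left_in m (f : ssub (fibre sq_cut ord0) m) :
  Ispan m (act (sval f : mono m n) x).
Proof.
case: f => f /(_ ord_max) /=; rewrite /sq_cut_fun.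
have low (g : mono n 1) : g (f ord_max) <> ord_max -> forall i, g (f i) = ord0.
  move=> gf i; case: (g (f i) =P ord0) => // /ord2P gi; case: gf.
  apply/ord2P => g0.
  by have := mono_leq g (mono_leq f (leq_ord i : i <= ord_max)); rewrite gi g0.
case: eqP => [_|/low h]; last by right.
by case: eqP => [//|/low h]; left.
Qed.

Lemma sq_left_nat k m (g : mono k m) (f : ssub (fibre sq_cut ord0) m) :
  exist (Ispan k) _ (sq_left_in (act g f)) =
  @act Isp _ _ g (exist (Ispan m) _ (sq_left_in f)).
Proof. exact: eq_exist. Qed.

Lemma sq_right_nat k m (g : mono k m) (f : ssub (fibre sq_cut ord_max) m) :
  constm k ord0 = @act (Delta 0) _ _ g (constm m ord0).
Proof. exact: monoP. Qed.

Definition sq_to_cone : sjoin Isp (Delta 0) n :=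
  @JoinSimp Isp (Delta 0) n sq_cut
    (@SMap (ssub (fibre sq_cut ord0)) Isp
       (fun m f => exist (Ispan m) _ (sq_left_in f)) sq_left_nat)
    (@SMap (ssub (fibre sq_cut ord_max)) (Delta 0)
       (fun m f => constm m ord0) sq_right_nat).

End ConeInverse.

Lemma sq_to_coneK n : cancel (@sq_to_cone n) (@cone_to_sq n).
Proof.
move=> x; rewrite [RHS]surjective_pairing /=; congr pair; apply: monoP => i.
  case: (sq_cut x i =P ord0) => [ie|ie] /=.
    by rewrite (@cone_ext_fun0 _ _ _ (sq_to_cone x) i ie).
  rewrite (@cone_ext_fun1 _ _ _ (sq_to_cone x) i ie).
  by move: ie; rewrite /= /sq_cut_fun; case: ifP => // /andP [/eqP ->].
case: (sq_cut x i =P ord0) => [ie|ie] /=.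
  by rewrite (@cone_ext_fun0 _ _ _ (sq_to_cone x) i ie).
rewrite (@cone_ext_fun1 _ _ _ (sq_to_cone x) i ie).
by move: ie; rewrite /= /sq_cut_fun; case: ifP => // /andP [_ /eqP ->].
Qed.

Lemma cone_to_sqK n : cancel (@cone_to_sq n) (@sq_to_cone n).
Proof.
move=> s; apply: join_ext.
- apply: monoP => i /=; rewrite /sq_cut_fun /=.
  case: (jcut s i =P ord0) => [ie|ie]; last first.
    by rewrite !cone_ext_fun1 // (ord2P ie).
  rewrite !(cone_ext_fun0 _ ie) ie /=.
  by case: (proj2_sig (jleft s 0 (fibre_vertex ie))) => ->; rewrite ?andbF.
- move=> m x h h'.
  have h1 := cone_ext_simplex (smap_comp (sfst _ _) res_incl)
               (exist (fibre (jcut s) ord0 m) x h').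
  have h2 := cone_ext_simplex (smap_comp (ssnd _ _) res_incl)
               (exist (fibre (jcut s) ord0 m) x h').
  move: h1 h2 => /=; case: (jleft s m _) => -[a b] ab /= h1 h2.
  by apply: eq_exist; congr pair; apply: monoP => j; [exact: h1 | exact: h2].
- by move=> m x h h'; apply: monoP => j; rewrite !ord1.
Qed.

Lemma cone_to_sq_bij n : bijective (@cone_to_sq n).
Proof. exact: Bijective (@cone_to_sqK n) (@sq_to_coneK n). Qed.

Lemma cone_to_sq_inl :
  smap_comp cone_to_sq (join_inl Isp (Delta 0)) = res_incl.
Proof.
apply: smapP => n x.
have h1 := congr1 (fun u : smap _ _ => u n x)
  (cone_ext_inl (smap_comp (sfst (Delta 1) (Delta 1)) res_incl)).
have h2 := congr1 (fun u : smap _ _ => u n x)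
  (cone_ext_inl (smap_comp (ssnd (Delta 1) (Delta 1)) res_incl)).
by rewrite [RHS]surjective_pairing; exact: congr2 h1 h2.
Qed.

Lemma sq_coneP (C : sset) (sq : smap Jsq C) :
  smap_comp (smap_comp sq cone_to_sq) (join_inl Isp (Delta 0)) =
  smap_comp sq res_incl.
Proof. by rewrite -cone_to_sq_inl; exact: smapP. Qed.

(* A square, as a vertex of the slice under its restriction to I *)
Definition sq_cone (C : sset) (sq : smap Jsq C) :
  slice (smap_comp sq res_incl) 0 := exist _ _ (sq_coneP sq).

(* A colimit cocone is an initial object of the slice. *)
Definition pushout_square (C : sset) (sq : smap Jsq C) : Prop :=
  initial (sq_cone sq).

Section Cofibrations.
Variables (C : sset) (cof : C 1 -> Prop).

Definition edge_cof (A : sset) (l : A 1) (d : sexp A C 0) : Prop :=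
  cof (vertex_map d 1 l).

Definition CI_co : sset := ssub (full (edge_cof left_edgeI)).

Definition CJ_co : sset := ssub (full (edge_cof left_edgeJ)).

Definition CJ_co_po : sset :=
  ssub (full (fun d : sexp Jsq C 0 =>
    edge_cof left_edgeJ d /\ pushout_square (vertex_map d))).

Lemma CJ_co_po_sub n (x : CJ_co_po n) :
  full (edge_cof left_edgeJ) n (sincl _ n x).
Proof. by move=> v; have [] := proj2_sig x v. Qed.

Definition CJ_co_po_incl : smap CJ_co_po CJ_co := slift CJ_co_po_sub.

Lemma res_po_co n (x : CJ_co_po n) :
  full (edge_cof left_edgeI) n (sexp_pre C res_incl n (sincl _ n x)).
Proof. by move=> v; have [] := proj2_sig x v. Qed.

Definition res_po : smap CJ_co_po CI_co :=
  @slift _ _ _ (smap_comp (sexp_pre C res_incl) (sincl _)) res_po_co.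

Definition admits_pushouts : Prop :=
  forall d : CI_co 0, exists s : CJ_co_po 0, res_po 0 s = d.

Definition functorial_choice (F : smap CI_co CJ_co_po) : Prop :=
  smap_comp res_po F = smap_id CI_co.

(* The 1-simplex beta(k, -) is the value of beta at (s_0 k, id_[1]). *)
Definition objectwise (K : sset) (beta : sexp K C 1) : Prop :=
  forall k : K 0, cof (beta 1 (identity k, idm 1)).

End Cofibrations.

(* The isomorphism ((C^A)_co)^K = ((C^K)^A)_co, used for A = I, J with l the
   left vertical map *)
Section SwapCo.
Variables (C : sset) (cof : C 1 -> Prop) (K A : sset) (l : A 1).

Local Notation CA_co := (ssub (full (edge_cof cof l))).
Local Notation CKA_co := (ssub (full (edge_cof (@objectwise C cof K) l))).

Lemma swap_coP n (y : sexp K CA_co n) :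
  full (edge_cof (@objectwise C cof K) l) n
    (swap K A C n (sexp_post K (sincl _) n y)).
Proof.
move=> v k /=.
have := proj2_sig (y 0 (k, v : Delta n 0)) (idm 0).
rewrite /edge_cof /= act_id.
have -> : compm v (compm (constm 1 ord0) (idm 1)) =
          act (constm 1 ord0) (v : Delta n 0) by [].
have /= -> := smap_nat y (constm 1 ord0) (k, v : Delta n 0).
by [].
Qed.

Definition swap_co : smap (sexp K CA_co) CKA_co :=
  @slift _ _ _ (smap_comp (swap K A C) (sexp_post K (sincl _))) swap_coP.

Lemma unswap_coP n (z : CKA_co n) m (x : sprod K (Delta n) m) :
  full (edge_cof cof l) m ((swap A K C n (sval z) : smap _ _) m x).
Proof.
move=> v.
have := proj2_sig z (compm x.2 v) (act v x.1).
by rewrite /edge_cof /= /identity -act_comp.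
Qed.

Definition unswap_co1 n (z : CKA_co n) : sexp K CA_co n :=
  slift (unswap_coP z).

Lemma unswap_co_nat m n (f : mono m n) (z : CKA_co n) :
  unswap_co1 (act f z) = act f (unswap_co1 z).
Proof. by apply: smapP => k x; apply: eq_exist; exact: smapP. Qed.

Definition unswap_co : smap CKA_co (sexp K CA_co) := SMap unswap_co_nat.

Lemma swap_coK : smap_comp unswap_co swap_co = smap_id _.
Proof.
apply: smapP => n y; apply: smapP => m x /=.
have := congr1 (fun u : smap _ (sexp K (sexp A C)) =>
  u n (sexp_post K (sincl _) n y) m x) (swapK K A C).
case E: (y m x) => [d dco] /= h; apply: eq_exist.
by rewrite h E.
Qed.

Lemma unswap_coK : smap_comp swap_co unswap_co = smap_id _.
Proof.
apply: smapP => n [z zco]; apply: eq_exist => /=.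
have := congr1 (fun u : smap _ _ => u n z) (swapK A K C) => /= {2}<-.
by congr swap1; exact: smapP.
Qed.

End SwapCo.

(* (F_po)^K, as a map from (C^K)^I_co to (C^K)^J_co, under the isomorphisms
   above and the inclusion of (C^J_co,po)^K in (C^J_co)^K *)
Definition exp_choice (C : sset) (cof : C 1 -> Prop) (K : sset)
  (F : smap (CI_co cof) (CJ_co_po cof)) :
  smap (CI_co (objectwise cof (K := K))) (CJ_co (objectwise cof (K := K))) :=
  smap_comp (swap_co cof K left_edgeJ)
    (smap_comp (sexp_post K (CJ_co_po_incl cof))
      (smap_comp (sexp_post K F) (unswap_co cof K left_edgeI))).

(* Main.v *)
Require Import Defs.
From mathcomp Require Import all_boot boolp zify.
From mathcomp Require classical_sets.

Set Implicit Arguments.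
Unset Strict Implicit.
Unset Printing Implicit Defensive.

(** A functorial choice of pushouts is a section of the restriction from
    pushout squares to spans.  The theorem rests on two facts.  First,
    functorial choices exist in C (pushouts_functorial), although only
    pushouts of single spans are given.  Second, a square in the exponential
    C^K is a pushout as soon as its value at each vertex of K is one
    (objectwise_pushout).  Given these, post-composition with a functorial
    choice F lands in pushout squares and is a section because F is one; and
    the pushout of a span in C^K is found by applying this to any F.

    Both facts are instances of one extension property, family_extension.
    Consider, for each simplex of K, a map to C defined on the product of
    Delta[m] with I * (boundary of Delta[N]), compatibly; it extends to I *
    Delta[N], provided the square that it contains over each vertex of K is a
    pushout.  For N = 0 the data are spans, and the extension turns them into
    squares, once pushouts have been chosen at the vertices of K.  For N > 0
    they are spheres in the slice under a span whose first vertex is a pushout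
    square, and the extension is a filler of the sphere.

    By induction on the skeleta of K, carried out with Zorn's lemma
    (skeletal_lift), the property reduces to the case of one cell, where a map
    has to be extended to (I * Delta[N]) x Delta[m] from the simplices that
    miss a vertex of Delta[N] or of Delta[m] (cell_extension).  A simplex of
    this product is a chain in a finite poset, made of a part in I x [m]
    followed by a part in [N] x [m].  If the second part does not meet the row
    0 of [m], the simplex can be attached along an inner horn: there is a
    matching of these chains that inserts or removes one inner vertex, and a
    weight that puts the simplices in a suitable order (inner_stage).
    Otherwise the first part lies in I x {0}, and what remains to be defined
    is a map from Delta[m] x Delta[N] to the slice under a span, on simplices
    that begin at the vertex (0, 0).  That vertex goes to a pushout square, an
    initial vertex of the slice, so spheres that begin there can be filled
    (outer_stage). *)

(** * Monotone maps *)

Lemma mono_ge_id n (f : mono n n) :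
  injective f -> forall i : 'I_n.+1, i <= f i.
Proof.
move=> f_inj [i lt_i]; elim: i lt_i => //= i IHi lt_i.
have lt_i' : i < n.+1 by apply: ltn_trans lt_i.
apply: leq_ltn_trans (IHi lt_i') _.
rewrite ltn_neqAle mono_leq //= andbT.
by apply/eqP => /val_inj /f_inj /(congr1 val) /= /n_Sn.
Qed.

Lemma mono_rev_leq n (f : mono n n) (i j : 'I_n.+1) :
  i <= j -> rev_ord (f (rev_ord i)) <= rev_ord (f (rev_ord j)).
Proof.
by move=> ij; rewrite leq_sub2l // ltnS mono_leq // leq_sub2l.
Qed.

Lemma mono_inj_id n (f : mono n n) : injective f -> f = idm n.
Proof.
move=> f_inj; apply: monoP => i; apply/val_inj/eqP.
rewrite eqn_leq (mono_ge_id f_inj) andbT.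
have g_inj : injective (Mono (@mono_rev_leq n f)).
  by move=> j k /rev_ord_inj /f_inj /rev_ord_inj.
have := mono_ge_id g_inj (rev_ord i); rewrite /= rev_ordK.
by have := ltn_ord i; have := ltn_ord (f i); lia.
Qed.

Lemma mono_strict m n (f : mono m n) (i j : 'I_m.+1) : f i < f j -> i < j.
Proof. by rewrite !ltnNge; apply: contra; exact: mono_leq. Qed.

Definition surj m n (f : mono m n) := forall j, exists i, f i = j.

Lemma mono_section m n (f : mono m n) (i : 'I_m.+1) :
  surj f -> exists2 r : mono n m, compm f r = idm n & r (f i) = i.
Proof.
move=> /choice [r0 r0K].
pose r j := if j == f i then i else r0 j.
have rK j : f (r j) = j by rewrite /r; case: eqP => [->|].
have r_leq (j k : 'I_n.+1) : j <= k -> r j <= r k.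
  rewrite leq_eqVlt => /orP [/eqP/val_inj -> //|].
  by rewrite -{1}(rK j) -{1}(rK k) => /mono_strict/ltnW.
by exists (Mono r_leq); [exact: monoP | rewrite /= /r eqxx].
Qed.

(** A section of f is injective, so it is the identity. *)
Lemma mono_surj_id n (f : mono n n) : surj f -> f = idm n.
Proof.
move=> /(mono_section ord0) [r fr _].
have frE i : f (r i) = i by have := congr1 (fun h : mono n n => h i) fr.
have r_id : r = idm n.
  by apply: mono_inj_id => i j rij; rewrite -[i]frE rij frE.
by apply: monoP => i; have := frE i; rewrite r_id.
Qed.

(** Some section of f passes through any prescribed point, so the sections see
    every point at which f and g could differ. *)
Lemma mono_sections_eq m n (f g : mono m n) :
  surj f ->
  (forall r : mono n m, compm f r = idm n -> surj (compm g r)) -> f = g.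
Proof.
move=> f_surj fg; apply: monoP => i.
have [r fr ri] := mono_section i f_surj.
have := congr1 (fun h : mono n n => h (f i)) (mono_surj_id (fg r fr)).
by rewrite /= ri.
Qed.

Lemma lift_leq n (j : 'I_n.+2) (i k : 'I_n.+1) : i <= k -> lift j i <= lift j k.
Proof. by rewrite /= leq_bump2. Qed.

Definition face n (j : 'I_n.+2) : mono n n.+1 := Mono (lift_leq j).

Lemma collapse_subproof n (j i : 'I_n.+2) : minn (unbump j i) n < n.+1.
Proof. by rewrite ltnS geq_minr. Qed.

Lemma collapse_leq n (j i k : 'I_n.+2) :
  i <= k -> minn (unbump j i) n <= minn (unbump j k) n.
Proof. by rewrite /unbump; lia. Qed.

Definition collapse n (j : 'I_n.+2) : mono n.+1 n :=
  @Mono n.+1 n (fun i => Ordinal (collapse_subproof j i)) (@collapse_leq n j).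

Lemma collapseK n (j i : 'I_n.+2) : i != j -> face j (collapse j i) = i.
Proof.
move=> ij; apply: val_inj; rewrite /= /bump /unbump.
have {}ij : i != j :> nat by [].
by have := ltn_ord i; have := ltn_ord j; lia.
Qed.

Lemma face_neq n (j : 'I_n.+2) i : face j i != j.
Proof. by rewrite eq_sym neq_lift. Qed.

Lemma factor_face m n (t : mono m n.+1) (j : 'I_n.+2) :
  (forall i, t i != j) -> t = compm (face j) (compm (collapse j) t).
Proof.
move=> tj; apply: monoP => i.
by rewrite -[RHS]/(face j (collapse j (t i))) collapseK.
Qed.

Lemma not_boundary_surj m n (t : mono m n) : ~ boundary n m t -> surj t.
Proof.
move=> nbd j; apply: contra_notP nbd => tj; exists j => i.
by apply/eqP => ti; apply: tj; exists i.
Qed.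

Lemma boundary0_empty m (t : mono m 0) : ~ boundary 0 m t.
Proof. by case=> j /(_ ord0); rewrite !ord1. Qed.

(** * Partial maps *)

Lemma sval_inj (T : Type) (P : T -> Prop) (x y : {z : T | P z}) :
  sval x = sval y -> x = y.
Proof. by case: x y => [x Px] [y Py] /= xy; exact: eq_exist. Qed.

(** A partial map from X to S is encoded by its graph, a simplicial subset of
    X x S, so that extending it is enlarging a subset and a chain of
    extensions has its union as an upper bound. *)
Definition functional (X S : sset) (G : subsset (sprod X S)) :=
  forall n (x : X n) y y', G n (x, y) -> G n (x, y') -> y = y'.

Definition sdom (X S : sset) (G : subsset (sprod X S)) n (x : X n) :=
  exists y, G n (x, y).

Definition sle (Z : sset) (G H : subsset Z) := forall n z, G n z -> H n z.

Lemma sdom_act (X S : sset) (G : subsset (sprod X S)) m n (f : mono m n) x :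
  sdom G x -> sdom G (act f x).
Proof. by case=> y /(smem_act f) Gxy; exists (act f y). Qed.

Lemma sdom_sle (X S : sset) (G H : subsset (sprod X S)) n (x : X n) :
  sle G H -> sdom G x -> sdom H x.
Proof. by move=> GH [y /GH Hxy]; exists y. Qed.

(** The values picked by choice are compatible with the simplicial structure
    because G is single-valued. *)
Lemma pullback_total (Y X S : sset) (G : subsset (sprod X S)) (j : smap Y X) :
  functional G -> (forall n (y : Y n), sdom G (j n y)) ->
  exists u : smap Y S, forall n y, G n (j n y, u n y).
Proof.
move=> G_fun Gj.
pose u n y := projT1 (cid (Gj n y)).
have uP n y : G n (j n y, u n y) by rewrite /u; case: cid.
have u_nat m n (f : mono m n) y : u m (act f y) = act f (u n y).
  by apply: G_fun (uP _ _) _; rewrite smap_nat; exact: smem_act f _ (uP n y).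
by exists (SMap u_nat).
Qed.

Definition simplex_map (X : sset) n (x : X n) : smap (Delta n) X :=
  @SMap (Delta n) X (fun m t => act t x) (fun _ _ f t => act_comp t f x).

Lemma glue_act (X S : sset) (G : subsset (sprod X S)) n (x : X n) (y : S n)
  l m (f : mono l m) (z : sprod X S m) :
  (G m z \/ exists t : mono m n, z = (act t x, act t y)) ->
  (G l (act f z) \/ exists t : mono l n, act f z = (act t x, act t y)).
Proof.
case=> [Gz|[t ->]]; first by left; exact: smem_act.
by right; exists (compm t f); rewrite !act_comp.
Qed.

Definition glue (X S : sset) (G : subsset (sprod X S)) n (x : X n) (y : S n) :
  subsset (sprod X S) := SubSSet (glue_act (G := G) (x := x) (y := y)).

(** Away from the domain of G the value at a simplex act t x is unambiguous
    because t can be recovered from it; in the domain G decides. *)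
Lemma glue_functional (X S : sset) (G : subsset (sprod X S)) n (x : X n)
  (y : S n) :
  functional G ->
  (forall m (t : mono m n), sdom G (act t x) -> G m (act t x, act t y)) ->
  (forall m (t t' : mono m n), ~ sdom G (act t x) -> act t x = act t' x ->
     t = t') ->
  functional (glue G x y).
Proof.
move=> G_fun Gx x_inj m z y1 y2 [G1|[t1 []]].
  case=> [G2|[t2 [zE yE]]]; first exact: G_fun G1 G2.
  by rewrite yE; apply: (G_fun _ z) => //; rewrite zE; apply: Gx; exists y1;
     rewrite -zE.
move=> z1 ->; case=> [G2|[t2 [z2 ->]]].
  by apply: (G_fun _ z) => //; rewrite z1; apply: Gx; exists y2; rewrite -z1.
have [Gz|/x_inj t_eq] := pselect (sdom G (act t1 x)); last first.
  by rewrite (t_eq t2) // -z1.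
apply: (G_fun _ z); first by rewrite z1; exact: Gx.
by rewrite z2; apply: Gx; rewrite -z2 z1.
Qed.

Lemma sle_glue (X S : sset) (G : subsset (sprod X S)) n (x : X n) (y : S n) :
  sle G (glue G x y).
Proof. by move=> m z; left. Qed.

Lemma glue_mem (X S : sset) (G : subsset (sprod X S)) n (x : X n) (y : S n) :
  glue G x y n (x, y).
Proof. by right; exists (idm n); rewrite !act_id. Qed.

Definition chain (Z : sset) (F : subsset Z -> Prop) :=
  forall G H, F G -> F H -> sle G H \/ sle H G.

Lemma union_act (Z : sset) (F : subsset Z -> Prop) m n (f : mono m n)
  (z : Z n) :
  (exists2 G : subsset Z, F G & G n z) ->
  exists2 G : subsset Z, F G & G m (act f z).
Proof. by case=> G FG Gz; exists G => //; exact: smem_act. Qed.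

Definition union (Z : sset) (F : subsset Z -> Prop) : subsset Z :=
  SubSSet (@union_act Z F).

Lemma union_functional (X S : sset) (F : subsset (sprod X S) -> Prop) :
  chain F -> (forall G, F G -> functional G) -> functional (union F).
Proof.
move=> F_chain F_fun n x y y' [G FG Gy] [H FH Hy'].
by have [/(_ _ _ Gy) Hy|/(_ _ _ Hy') Gy'] := F_chain _ _ FG FH;
   [exact: F_fun FH _ _ _ _ Hy Hy' | exact: F_fun FG _ _ _ _ Gy Gy'].
Qed.

Lemma subsset_zorn (Z : sset) (P : subsset Z -> Prop) (G0 : subsset Z) :
  P G0 ->
  (forall F : subsset Z -> Prop, chain F -> F G0 ->
     (forall G, F G -> P G) -> P (union F)) ->
  exists G, [/\ P G, sle G0 G & forall H, P H -> sle G H -> sle H G].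
Proof.
move=> PG0 P_union.
pose T := {G : subsset Z | P G /\ sle G0 G}.
pose R (G H : T) := `[< sle (sval G) (sval H) >].
pose t0 : T := exist _ G0 (conj PG0 (fun _ _ h => h)).
have [||A A_chain|[G [PG G0G]] G_max] := @classical_sets.ZL_preorder T t0 R.
- by move=> G; apply/asboolP.
- by move=> G H K /asboolP HG /asboolP GK; apply/asboolP => n z /HG /GK.
- pose F G := G = G0 \/ exists2 t, A t & sval t = G.
  have F_P G : F G -> P G by case=> [->|[[H [PH ?]] _ <-]].
  have F_chain : chain F.
    move=> G H [->|[t At <-]]; first by case=> [->|[t At <-]]; left=> //;
      case: (proj2_sig t).
    case=> [->|[t' At' <-]]; first by right; case: (proj2_sig t).
    by case: (A_chain t t' At At') => /asboolP; [left | right].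
  have FG0 : F G0 by left.
  have UP : P (union F) /\ sle G0 (union F).
    by split; [exact: P_union | move=> n z Gz; exists G0].
  exists (exist _ (union F) UP) => t At; apply/asboolP => n z tz.
  by exists (sval t) => //; right; exists t.
exists G; split=> // H PH GH.
have HP : P H /\ sle G0 H by split=> // n z /G0G /GH.
by apply/asboolP; apply: (G_max (exist _ H HP)); exact/asboolP.
Qed.

(** A simplex of minimal dimension outside the domain of a maximal partial map
    has its boundary in the domain, so the sphere given by the hypothesis lets
    the partial map be extended. *)
Lemma skeletal_lift (K S : sset) (A : subsset (sprod K S)) :
  (forall n (x : K n) (s : smap (ssub (boundary n)) S),
     (forall m (t : ssub (boundary n) m), A m (act (sval t) x, s m t)) ->
     exists2 y : S n, A n (x, y) &
       forall m (t : ssub (boundary n) m), act (sval t) y = s m t) ->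
  exists u : smap K S, forall n x, A n (x, u n x).
Proof.
move=> A_fill.
pose P (G : subsset (sprod K S)) := functional G /\ sle G A.
pose G0 : subsset (sprod K S) :=
  @SubSSet (sprod K S) (fun _ _ => False) (fun _ _ _ _ h => h).
have [|F F_chain FG0 F_P|G [[G_fun GA] _ G_max]] := @subsset_zorn _ P G0.
- by split.
- split; first by apply: union_functional => // G /F_P [].
  by move=> n z [G /F_P [_ GA] /GA].
suff G_total n (x : K n) : sdom G x.
  have [u uP] := @pullback_total K K S G (smap_id K) G_fun G_total.
  by exists u => n x; exact/GA/uP.
elim/ltn_ind: n x => n IHn x.
have [//|xG] := pselect (sdom G x).
have bdG m (t : Delta n m) : boundary n m t -> sdom G (act t x).
  case: n t IHn x {xG} => [|n] t IHn x; first by move=> /boundary0_empty.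
  case=> j /factor_face ->; rewrite !act_comp.
  by do 2!apply: sdom_act; exact: IHn.
have [s sP] : exists s : smap (ssub (boundary n)) S,
    forall m (t : ssub (boundary n) m), G m (act (sval t) x, s m t).
  by apply: (@pullback_total _ _ _ _
    (smap_comp (simplex_map x) (sincl (boundary n))) G_fun) => m t;
    exact/bdG/(proj2_sig t).
have [|y Axy yP] := A_fill n x s; first by move=> m t; exact/GA/sP.
have surjG m (t : mono m n) : surj t -> ~ sdom G (act t x).
  move=> t_surj tG; have [r tr _] := mono_section ord0 t_surj.
  by apply: xG; rewrite -(act_id x) -tr act_comp; exact: sdom_act.
have PH : P (glue G x y).
  split; last by move=> m z [/GA //|[t ->]]; exact: (smem_act t Axy).
  apply: glue_functional => // m t.
    move=> tG; have tbd : boundary n m t.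
      by apply: contrapT => /not_boundary_surj/surjG.
    by rewrite (yP m (exist _ t tbd)); exact: sP (exist _ t tbd).
  (* If t and t' differed, a section of t would exhibit x as a simplex obtained
     from its boundary. *)
  move=> t' tG tt'; have t_surj : surj t.
    by apply: not_boundary_surj => /bdG.
  apply: mono_sections_eq => // r tr; apply: not_boundary_surj => /bdG.
  by rewrite act_comp -tt' -act_comp tr act_id.
exists y; apply: (G_max (glue G x y)) => //; first exact: sle_glue.
exact: glue_mem.
Qed.

(** * Simplices of the join of the span with a simplex *)

Local Notation cone n := (sjoin Isp (Delta n)).
Local Notation cone_map t := (sjoin_map (smap_id Isp) (Delta_map t)).

Definition apex k (b : Jsq k) (i : 'I_k.+1) :=
  (b.1 i == ord_max) && (b.2 i == ord_max).

(** The simplex of I * Delta[n] that runs through J = I * Delta[0] along b,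
    the cone point of J being replaced at each vertex i by z i. *)
Definition jpt n k (b : Jsq k) (z : mono k n) : cone n k :=
  @JoinSimp Isp (Delta n) k (sq_cut b) (jleft (sq_to_cone b))
    (yoneda_fibre (z : Delta n k) _ _).

Lemma jpt_act n l k (f : mono l k) (b : Jsq k) (z : mono k n) :
  act f (jpt b z) = jpt (act f b) (compm z f).
Proof.
apply: join_ext => [|m x h h'|m x h h']; first exact: monoP.
  exact: eq_exist.
by [].
Qed.

Lemma jpt_map n n' k (t : mono n n') (b : Jsq k) (z : mono k n) :
  sjoin_map (smap_id Isp) (Delta_map t) k (jpt b z) = jpt b (compm t z).
Proof. exact: join_eq. Qed.

Lemma jpt0 k (b : Jsq k) (z : mono k 0) : jpt b z = sq_to_cone b.
Proof. by apply: join_eq => // m x; apply: monoP => i; rewrite !ord1. Qed.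

(** The position in the square: Delta[n] is collapsed to the cone point of J =
    I * Delta[0]. *)
Definition base n : smap (cone n) Jsq :=
  smap_comp cone_to_sq (cone_map (constm n (@ord0 0))).

Lemma base_jpt n k (b : Jsq k) (z : mono k n) : base n k (jpt b z) = b.
Proof.
have -> : base n k (jpt b z) =
  cone_to_sq k (cone_map (constm n (@ord0 0)) k (jpt b z)) by [].
by rewrite jpt_map jpt0 sq_to_coneK.
Qed.

Section Height.
Variables (n k : nat) (s : cone n k).

(** The position in Delta[n], extended by 0 to the vertices in the span. *)
Definition height_fun (i : 'I_k.+1) : 'I_n.+1 :=
  match jcut s i =P ord_max with
  | ReflectT ie => (jright s 0 (fibre_vertex ie) : mono 0 n) ord0
  | ReflectF _ => ord0
  end.

Lemma height_fun1 i (ie : jcut s i = ord_max) :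
  height_fun i = (jright s 0 (fibre_vertex ie) : mono 0 n) ord0.
Proof.
rewrite /height_fun; case: eqP => [ie'|//].
by rewrite (Prop_irrelevance ie ie').
Qed.

Lemma height_fun0 i : jcut s i <> ord_max -> height_fun i = ord0.
Proof. by rewrite /height_fun; case: eqP. Qed.

Lemma height_fun_simplex m (x : ssub (fibre (jcut s) ord_max) m) j :
  height_fun ((sval x : mono m k) j) = (jright s m x : mono m n) j.
Proof.
rewrite (height_fun1 (proj2_sig x j)).
have -> : fibre_vertex (proj2_sig x j) = act (constm 0 j) x.
  by apply: eq_exist; exact: monoP.
by rewrite !smap_nat.
Qed.

Lemma height_leq (i j : 'I_k.+1) : i <= j -> height_fun i <= height_fun j.
Proof.
move=> ij; case: (jcut s i =P ord_max) => [ie|/height_fun0 -> //].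
pose e (l : 'I_2) := if l == ord0 then i else j.
have e_leq (l l' : 'I_2) : l <= l' -> e l <= e l'.
  by rewrite /e -!val_eqE /=; case: l l' => [[|[|//]] ?] [[|[|//]] ?].
have ee (l : 'I_2) : jcut s (e l) = ord_max.
  apply: ord2P => el; have : jcut s i <= jcut s (e l).
    by apply: mono_leq; rewrite /e; case: ifP.
  by rewrite ie el.
pose x : ssub (fibre (jcut s) ord_max) 1 :=
  exist (fibre (jcut s) ord_max 1) (Mono e_leq) ee.
have := height_fun_simplex x ord0; have := height_fun_simplex x ord_max.
by rewrite /= {1 2}/e /= => -> ->; apply: mono_leq.
Qed.

Definition height : mono k n := Mono height_leq.

End Height.

Lemma height_act n l k (f : mono l k) (s : cone n k) :
  height (act f s) = compm (height s) f.
Proof.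
apply: monoP => i /=; case: (jcut s (f i) =P ord_max) => [ie|ie].
  rewrite (@height_fun1 _ _ (act f s) i ie) (height_fun1 ie) /=.
  congr (mono_fun (jright s 0 _) _).
  by apply: eq_exist; exact: monoP.
by rewrite (@height_fun0 _ _ (act f s) i ie) (height_fun0 ie).
Qed.

Lemma sq_cut_apex k (b : Jsq k) i : (sq_cut b i == ord_max) = apex b i.
Proof. by rewrite /= /sq_cut_fun /apex; case: ifP. Qed.

Lemma cut_base n k (s : cone n k) : sq_cut (base n k s) = jcut s.
Proof.
by rewrite -[RHS]/(jcut (cone_map (constm n (@ord0 0)) k s))
  -[in RHS](cone_to_sqK (sjoin_map _ _ k s)).
Qed.

Lemma height_jpt n k (b : Jsq k) (z : mono k n) i :
  height (jpt b z) i = if apex b i then z i else ord0.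
Proof.
rewrite -sq_cut_apex /=; case: eqP => ie.
  by rewrite (@height_fun1 _ _ (jpt b z) i ie).
exact: (@height_fun0 _ _ (jpt b z) i ie).
Qed.

Lemma jleft_eq (X Y : sset) n (s s' : sjoin X Y n) m (x : mono m n) h h' :
  s = s' -> jleft s m (exist _ x h) = jleft s' m (exist _ x h').
Proof.
by move=> ss'; case: s' / ss' h' => h'; rewrite (Prop_irrelevance h h').
Qed.

Lemma jptE n k (s : cone n k) : s = jpt (base n k s) (height s).
Proof.
have cut_s := cut_base s.
pose s0 := cone_map (constm n (@ord0 0)) k s.
have s0E : s0 = sq_to_cone (base n k s) by rewrite cone_to_sqK.
apply: join_ext => [|m x h h'|m x h h']; first by rewrite /= cut_s.
  have E : jleft s m (exist _ x h) = jleft s0 m (exist _ x h) by [].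
  apply: etrans E _.
  exact: (@jleft_eq Isp (Delta 0) k s0 (sq_to_cone (base n k s)) m x).
apply: monoP => i.
by rewrite -(height_fun_simplex (exist (fibre (jcut s) ord_max m) x h)).
Qed.

Lemma height_nonapex n k (s : cone n k) i :
  ~~ apex (base n k s) i -> height s i = ord0.
Proof. by rewrite {2}(jptE s) height_jpt => /negPf ->. Qed.

(** A simplex of the join is determined by its square and by its heights at
    the vertices where the square is at the apex. *)
Lemma jpt_eq n k (s s' : cone n k) :
  base n k s = base n k s' ->
  (forall i, apex (base n k s) i -> height s i = height s' i) -> s = s'.
Proof.
move=> bE hE; rewrite (jptE s) (jptE s') -bE.
congr jpt; apply: monoP => i.
have [/hE //|nap] := boolP (apex (base n k s) i).
by rewrite !height_nonapex // -bE.
Qed.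

Lemma apex_IspanP k (b : Jsq k) : Ispan k b <-> forall i, ~~ apex b i.
Proof.
split=> [[] bE i|nap]; rewrite /apex ?bE ?andbF //.
have f0 i : sq_cut b i = ord0.
  move: (nap i); rewrite -sq_cut_apex.
  by case: (sq_cut b i =P ord0) => // /ord2P ->.
have := sq_left_in (exist (fibre (sq_cut b) ord0 k) (idm k) f0).
by rewrite act_id.
Qed.

Lemma jpt_inl n k (x : Isp k) (z : mono k n) :
  join_inl Isp (Delta n) k x = jpt (sval x) z.
Proof.
have bE : base n k (join_inl Isp (Delta n) k x) = sval x.
  have := congr1 (fun u : smap Isp Jsq => u k x) cone_to_sq_inl.
  rewrite -[RHS]/(sval x) => <-; congr (cone_to_sq k _).
  by apply: join_eq => // m y; case: (fibre0_empty y).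
apply: jpt_eq; first by rewrite base_jpt.
move=> i; rewrite bE => ap.
by have /apex_IspanP/(_ i) := proj2_sig x; rewrite ap.
Qed.

Lemma sq_cone_jpt (C : sset) (sq : smap Jsq C) k (b : Jsq k) (z : mono k 0) :
  sval (sq_cone sq) k (jpt b z) = sq k b.
Proof. by rewrite jpt0 -{2}[b]sq_to_coneK. Qed.

(** * Simplices as chains of vertices *)

Section Chains.
Variables n m : nat.

Local Notation X := (sprod (cone n) (Delta m)).

(** The vertices of (I * Delta[n]) x Delta[m] lie in the product of two copies
    of [1] (the position in the square, the vertices of Delta[n] being at the
    apex), [n] (the height, equal to 0 off the apex) and [m] (the row). *)
Definition point : finType := ('I_2 * 'I_2 * 'I_n.+1 * 'I_m.+1)%type.

Definition height_of (q : point) := q.1.2.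
Definition row (q : point) := q.2.
Definition apexp (q : point) := (q.1.1.1 == ord_max) && (q.1.1.2 == ord_max).

Definition qle (u v : point) :=
  [&& u.1.1.1 <= v.1.1.1, u.1.1.2 <= v.1.1.2, u.1.2 <= v.1.2 & u.2 <= v.2].

Definition rank (q : point) := q.1.1.1 + q.1.1.2 + q.1.2 + q.2.

Lemma qle_refl q : qle q q. Proof. by rewrite /qle !leqnn. Qed.

Lemma qle_trans u v w : qle u v -> qle v w -> qle u w.
Proof.
move=> /and4P [u1 u2 u3 u4] /and4P [v1 v2 v3 v4].
by apply/and4P; split; [exact: leq_trans u1 v1 | exact: leq_trans u2 v2
                       | exact: leq_trans u3 v3 | exact: leq_trans u4 v4].
Qed.

Lemma qle_anti u v : qle u v -> qle v u -> u = v.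
Proof.
case: u v => [[[u1 u2] u3] u4] [[[v1 v2] v3] v4].
move=> /and4P [/= a1 a2 a3 a4] /and4P [/= b1 b2 b3 b4].
by congr (_, _, _, _); apply: val_inj; apply/eqP; rewrite eqn_leq; apply/andP.
Qed.

Lemma qle_rank_anti u v : qle u v -> rank v <= rank u -> u = v.
Proof.
move=> uv vu; apply: qle_anti => //; move: uv vu => /and4P [u1 u2 u3 u4].
by rewrite /rank /qle => vu; apply/and4P; split; lia.
Qed.

Lemma apexp_mono u v : qle u v -> apexp u -> apexp v.
Proof.
have top (a b : 'I_2) : a <= b -> a == ord_max -> b == ord_max.
  by move=> ab /eqP aE; apply/eqP/ord2P => b0; move: ab; rewrite aE b0.
move=> /and4P [h1 h2 _ _] /andP [/(top _ _ h1) v1 /(top _ _ h2) v2].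
exact/andP.
Qed.

Definition vtx k (x : X k) (i : 'I_k.+1) : point :=
  ((base n k x.1).1 i, (base n k x.1).2 i, height x.1 i, (x.2 : mono k m) i).

Definition supp k (x : X k) : {set point} := [set vtx x i | i in 'I_k.+1].

Definition chainp (S : {set point}) := {in S &, forall u v, qle u v || qle v u}.
Definition validp (S : {set point}) :=
  {in S, forall q, ~~ apexp q -> height_of q = ord0}.

Lemma vtx_act k l (f : mono k l) (x : X l) i : vtx (act f x) i = vtx x (f i).
Proof. by rewrite /vtx -[(act f x).1]/(act f x.1) smap_nat height_act. Qed.

Lemma vtx_leq k (x : X k) (i j : 'I_k.+1) : i <= j -> qle (vtx x i) (vtx x j).
Proof. by move=> ij; apply/and4P; split; apply: mono_leq. Qed.

Lemma mem_supp k (x : X k) i : vtx x i \in supp x.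
Proof. exact: imset_f. Qed.

Lemma supp_act k l (f : mono k l) (x : X l) : supp (act f x) \subset supp x.
Proof. by apply/subsetP => _ /imsetP [i _ ->]; rewrite vtx_act mem_supp. Qed.

Lemma supp_chain k (x : X k) : chainp (supp x).
Proof.
move=> _ _ /imsetP [i _ ->] /imsetP [j _ ->].
by have [ij|/ltnW ji] := leqP i j; apply/orP; [left | right]; exact: vtx_leq.
Qed.

Lemma supp_valid k (x : X k) : validp (supp x).
Proof. by move=> _ /imsetP [i _ ->]; exact: (@height_nonapex _ _ x.1 i). Qed.

Lemma vtx_inj k (x y : X k) : vtx x =1 vtx y -> x = y.
Proof.
move=> xy; rewrite [x]surjective_pairing [y]surjective_pairing; congr pair.
  apply: jpt_eq => [|i _]; last by have [] := xy i.
  rewrite [LHS]surjective_pairing [RHS]surjective_pairing.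
  by congr pair; apply: monoP => i; have [] := xy i.
by apply: monoP => i; have [] := xy i.
Qed.

(** A simplex is a monotone sequence of points, so its faces and their
    degeneracies are recognised on the sets of points: simplicial subsets
    become families of chains closed under passing to a smaller chain. *)
Lemma supp_sub_act k l (x : X k) (y : X l) :
  supp x \subset supp y -> exists f : mono k l, x = act f y.
Proof.
move=> /subsetP xy.
have ex i : exists j, vtx y j == vtx x i.
  by have /imsetP [j _ ->] := xy _ (mem_supp x i); exists j.
pose f i := [arg min_(j < xchoose (ex i) | vtx y j == vtx x i) val j].
have fP i : vtx y (f i) = vtx x i /\ forall j, vtx y j = vtx x i -> f i <= j.
  rewrite /f; case: arg_minnP => [|j /eqP yj j_min].
    exact: (xchooseP (ex i)).
  by split=> // j' /eqP /j_min.
have f_leq (i i' : 'I_k.+1) : i <= i' -> f i <= f i'.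
  move=> ii'; case/orP: (leq_total (f i) (f i')) => // lt_f.
  have [fi min_i] := fP i; have [fi' _] := fP i'.
  apply: min_i; rewrite fi'; apply: qle_anti; last exact: (vtx_leq x ii').
  by rewrite -fi -fi'; exact: (vtx_leq y lt_f).
exists (Mono f_leq); apply: vtx_inj => i; rewrite vtx_act.
by case: (fP i).
Qed.

(** Sorting by rank a totally ordered set of points orders it by the product
    order, since the rank is strictly monotone. *)
Lemma chain_simplex (S : {set point}) :
  chainp S -> validp S -> S != set0 ->
  exists k (x : X k), injective (vtx x) /\ supp x = S.
Proof.
move=> S_chain S_valid /set0Pn [q0 Sq0].
pose s := sort (fun u v => rank u <= rank v) (enum S).
have mem_s : s =i S by move=> q; rewrite mem_sort mem_enum.
have s_uniq : uniq s by rewrite sort_uniq enum_uniq.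
have [k s_size] : exists k, size s = k.+1.
  case: s mem_s {s_uniq} => [|q s] sE; last by exists (size s).
  by have := sE q0; rewrite Sq0.
pose v (i : 'I_k.+1) := nth q0 s i.
have vS i : v i \in S by rewrite -mem_s mem_nth // s_size.
have v_leq (i j : 'I_k.+1) : i <= j -> qle (v i) (v j).
  move=> ij; have : rank (v i) <= rank (v j).
    have s_sorted : sorted (fun u v => rank u <= rank v) s.
      by apply: sort_sorted => u w; exact: leq_total.
    apply: (sorted_leq_nth _ _ q0 s_sorted) => //; try by rewrite inE s_size.
    by move=> a b c; exact: leq_trans.
  have /orP [//|ji] := S_chain _ _ (vS i) (vS j).
  by move=> /(qle_rank_anti ji) ->; exact: qle_refl.
have h1 (i j : 'I_k.+1) : i <= j -> (v i).1.1.1 <= (v j).1.1.1.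
  by move=> /v_leq/and4P [].
have h2 (i j : 'I_k.+1) : i <= j -> (v i).1.1.2 <= (v j).1.1.2.
  by move=> /v_leq/and4P [].
have h3 (i j : 'I_k.+1) : i <= j -> (v i).1.2 <= (v j).1.2.
  by move=> /v_leq/and4P [].
have h4 (i j : 'I_k.+1) : i <= j -> (v i).2 <= (v j).2.
  by move=> /v_leq/and4P [].
pose b : Jsq k := (Mono h1, Mono h2).
exists k; exists (jpt b (Mono h3), Mono h4 : Delta m k).
have xE i : vtx (jpt b (Mono h3), Mono h4 : Delta m k) i = v i.
  rewrite /vtx base_jpt height_jpt /= [RHS]surjective_pairing; congr pair.
  rewrite [RHS]surjective_pairing; congr pair.
    by rewrite -surjective_pairing.
  by case: ifP => // /negbT nap; rewrite -[RHS]/(height_of (v i)) S_valid.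
split=> [i j|].
  rewrite !xE => /eqP; rewrite nth_uniq ?s_size // => /eqP; exact: val_inj.
apply/setP => q; apply/imsetP/idP => [[i _ ->]|]; first by rewrite xE.
rewrite -mem_s => /(nthP q0) [i]; rewrite s_size => lt_i <-.
by exists (Ordinal lt_i) => //; rewrite xE.
Qed.

Lemma chainS (S T : {set point}) : S \subset T -> chainp T -> chainp S.
Proof. by move=> /subsetP ST T_chain u v /ST uT /ST vT; exact: T_chain. Qed.

Lemma validS (S T : {set point}) : S \subset T -> validp T -> validp S.
Proof. by move=> /subsetP ST T_valid u /ST; exact: T_valid. Qed.

End Chains.

(** * Simplices attached along inner horns *)

Lemma horn_fill (X C : sset) (G : subsset (sprod X C)) k (x : X k)
  (i : 'I_k.+1) :
  quasicategory C -> functional G -> 0 < i < k ->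
  (forall l (t : Delta k l), horn i l t -> sdom G (act t x)) ->
  exists w : C k,
    forall l (t : Delta k l), horn i l t -> G l (act t x, act t w).
Proof.
move=> C_qcat G_fun i_inner hornG.
have [l t|h hP] := @pullback_total (ssub (horn i)) X C G
  (smap_comp (simplex_map x) (sincl (horn i))) G_fun.
  exact: hornG (proj2_sig t).
have [s sh] := C_qcat k i i_inner h.
exists (s k (idm k)) => l t ti; rewrite -smap_nat.
have := hP l (exist _ t ti); rewrite -sh /=.
by congr (G l (_, _)); congr (s l _).
Qed.

Section Matching.
Variables n m : nat.

Local Notation X := (sprod (cone n) (Delta m)).
Local Notation point := (point n m).
Implicit Types (S T : {set point}) (u v q : point).

(** These are the supports of the simplices of (I * Delta[n]) x Delta[m] that
    come from the boundary of Delta[m] or of Delta[n].  Only apex vertices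
    count for the latter, the height being conventional elsewhere. *)
Definition misses S :=
  (exists i : 'I_m.+1, forall q, q \in S -> row q != i) \/
  (exists j : 'I_n.+1, forall q, q \in S -> apexp q -> height_of q != j).

(** The supports that can be reached through inner horns.  In the other ones
    there is an apex vertex in row 0, hence the vertices in the span are in
    row 0 too, and this is where a pushout is needed. *)
Definition inner_supp S :=
  misses S \/ forall q, q \in S -> apexp q -> row q != ord0.

(** Here row u is the first row that contains an apex vertex, v is the last
    vertex of S in the row before it, and u is the translate of v to row u.
    As u can be added to or removed from S without changing the pair (u, v),
    the chains that have a mate are matched two by two. *)
Definition mate S u v :=
  [/\ v \in S /\ ~~ apexp v,
      u.1 = v.1 /\ row u = (row v).+1 :> nat,
      (forall q, q \in S -> apexp q -> row u <= row q),
      (exists2 q, q \in S & apexp q /\ row q = row u) &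
      (forall q, q \in S -> row q = row v -> qle q v)].

Lemma misses_sub S T : T \subset S -> misses S -> misses T.
Proof.
move=> /subsetP TS [[i Si]|[j Sj]]; [left; exists i | right; exists j].
  by move=> q /TS; exact: Si.
by move=> q /TS; exact: Sj.
Qed.

Lemma inner_supp_sub S T : T \subset S -> inner_supp S -> inner_supp T.
Proof.
move=> TS [/(misses_sub TS)|S0]; first by left.
by right=> q /(subsetP TS); exact: S0.
Qed.

Lemma apexp_eq u v : u.1 = v.1 -> apexp u = apexp v.
Proof. by rewrite /apexp => ->. Qed.

Lemma mate_nonapex S u v : mate S u v -> ~~ apexp u.
Proof. by case=> [[_ nap] [uv _] _ _ _]; rewrite (apexp_eq uv). Qed.

Lemma mate_inner S u v :
  mate S u v -> forall q, q \in S -> apexp q -> row q != ord0.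
Proof.
case=> [_ [_ uv] S_apex _ _] q qS q_apex.
have := S_apex q qS q_apex; rewrite uv -val_eqE /=; lia.
Qed.

(** Every row is visited, in particular the one just before the first apex
    vertex, and its vertices are in the span by minimality. *)
Lemma mate_exists S : chainp S -> ~ misses S ->
  (forall q, q \in S -> apexp q -> row q != ord0) ->
  exists u v, mate S u v.
Proof.
move=> S_chain S_full S_inner.
have [q1 /andP q1S] : exists q, (q \in S) && apexp q.
  apply: contra_notP S_full => no_apex; right; exists ord0 => q qS q_apex.
  by case: no_apex; exists q; apply/andP.
have [q /andP [qS q_apex] q_min] :=
  @arg_minnP _ q1 [pred q | (q \in S) && apexp q] (fun q => val (row q))
    (introT andP q1S).
have q_row : 0 < row q by rewrite lt0n; have := S_inner q qS q_apex.
have lt_p : (row q).-1 < m.+1 by apply: leq_ltn_trans (ltn_ord (row q)); lia.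
pose p := Ordinal lt_p.
have [r1 /andP r1S] : exists r, (r \in S) && (row r == p).
  apply: contra_notP S_full => no_r; left; exists p => r rS.
  by apply/eqP => rp; case: no_r; exists r; rewrite rS rp /=.
have [v /andP [vS /eqP vp] v_max] :=
  @arg_maxnP _ r1 [pred r | (r \in S) && (row r == p)] (fun r => rank r)
    (introT andP r1S).
exists (v.1, row q), v; split.
- split=> //; apply/negP => v_apex.
  have := q_min v; rewrite /= vS v_apex vp /= => /(_ isT); lia.
- by split=> //; rewrite vp /=; lia.
- by move=> r rS r_apex; apply: q_min; rewrite /= rS.
- by exists q.
- move=> r rS; rewrite vp => rp.
  have /orP [//|vr] := S_chain _ _ rS vS.
  have -> : v = r.
    by apply: qle_rank_anti vr _; apply: v_max; rewrite /= rS rp /=.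
  exact: qle_refl.
Qed.

Lemma mate_uniq S u v u' v' : mate S u v -> mate S u' v' -> u = u'.
Proof.
move=> [[vS v_na] [uv uv_row] u_min [q qS [q_apex qu]] v_max].
move=> [[v'S v'_na] [uv' uv'_row] u'_min [q' q'S [q'_apex q'u]] v'_max].
have row_u : row u = row u'.
  apply: val_inj; apply/eqP; rewrite eqn_leq -{2}qu -{1}q'u.
  by rewrite u_min // u'_min.
have row_v : row v = row v'.
  by apply: val_inj; apply/eqP; rewrite -eqSS -uv_row -uv'_row row_u.
have vE : v = v' by apply: qle_anti; [exact: v'_max | exact: v_max].
by rewrite [u]surjective_pairing [u']surjective_pairing uv uv' vE; congr pair.
Qed.

Lemma mate_between S T u v :
  S :\ u \subset T -> T \subset u |: S -> mate S u v -> mate T u v.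
Proof.
move=> /subsetP ST /subsetP TS uv_mate; have u_na := mate_nonapex uv_mate.
case: uv_mate => [[vS v_na] [uv uv_row] u_min [q qS [q_apex qu]] v_max].
have vu : v != u by apply/eqP => vu; move: uv_row; rewrite vu; lia.
split=> //.
- by split=> //; apply: ST; rewrite !inE vu.
- move=> r /TS; rewrite !inE => /orP [/eqP ->|]; last exact: u_min.
  by rewrite (negPf u_na).
- exists q => //; apply: ST; rewrite !inE qS andbT.
  by apply/eqP => qu'; rewrite -qu' q_apex in u_na.
- move=> r /TS; rewrite !inE => /orP [/eqP ->|]; last exact: v_max.
  by move=> uv'; move: uv_row; rewrite uv'; lia.
Qed.

(** A vertex of S in a later row than v is above v, hence above u; the others
    are below v. *)
Lemma mate_chain S u v : chainp S -> mate S u v -> chainp (u |: S).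
Proof.
move=> S_chain [[vS v_na] [uv uv_row] u_min _ v_max].
have vu : qle v u by rewrite /qle uv !leqnn /= -/(row v) -/(row u) uv_row.
have u_comp q : q \in S -> qle u q || qle q u.
  move=> qS; have [lt_uq|le_qv] := ltnP (row v) (row q).
    have /orP [/and4P [_ _ _ le_qv]|/and4P [q1 q2 q3 q4]] := S_chain _ _ qS vS.
      by move: lt_uq; rewrite ltnNge le_qv.
    by apply/orP; left; apply/and4P; rewrite uv -/(row u) uv_row.
  apply/orP; right; apply: qle_trans vu.
  have /orP [//|vq] := S_chain _ _ qS vS.
  apply: v_max => //; apply: val_inj; apply/eqP; rewrite eqn_leq le_qv.
  by move/and4P: vq => [].
move=> a b; rewrite !inE => /orP [/eqP ->|aS] /orP [/eqP ->|bS].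
- by rewrite qle_refl.
- exact: u_comp.
- by rewrite orbC; exact: u_comp.
- exact: S_chain.
Qed.

Lemma mate_valid S u v : validp S -> mate S u v -> validp (u |: S).
Proof.
move=> S_valid [[vS v_na] [uv _] _ _ _] q.
rewrite !inE => /orP [/eqP ->|/S_valid//].
by rewrite /height_of uv => _; apply: S_valid.
Qed.

Lemma mate_misses S u v : mate S u v -> misses S -> misses (u |: S).
Proof.
move=> uv; have u_na := mate_nonapex uv; case: uv => [_ _ _ [q qS [_ qu]] _].
case=> [[i Si]|[j Sj]]; [left; exists i | right; exists j] => r; rewrite !inE.
  by case/orP => [/eqP ->|/Si//]; rewrite -qu; exact: Si.
by case/orP => [/eqP ->|/Sj//]; rewrite (negPf u_na).
Qed.

(** The order in which simplices are attached: moving a vertex of the span to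
    the next row lowers the weight, and an apex outweighs any other vertex. *)
Definition wt q := if apexp q then m.+2 else m.+1 - row q.

Definition weight S := \sum_(q in S) wt q.

Lemma wt_gt0 q : 0 < wt q.
Proof. by rewrite /wt; case: ifP => // _; have := ltn_ord (row q); lia. Qed.

Lemma weightU u S : weight (u |: S) <= wt u + weight S.
Proof.
have [uS|uS] := boolP (u \in S); last by rewrite /weight big_setU1.
by rewrite (setUidPr _) ?sub1set // leq_addl.
Qed.

(** Completing a face of S by its own mate gives a lighter chain.  If the
    vertex q that is removed is an apex, its weight exceeds that of the new
    mate u'.  If q = v, then u' is in the same row as u, the row after that of
    v, so it is lighter than v.  Otherwise u' = u is still there. *)
Lemma mate_face_weight S u v q : chainp S -> mate S u v -> q \in S ->
  u \in S -> q != u -> ~ misses (S :\ q) ->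
  exists u' v', mate (S :\ q) u' v' /\ weight (u' |: S :\ q) < weight S.
Proof.
move=> S_chain uv qS uS qu S'_full.
have S'S : S :\ q \subset S by exact: subsetDl.
have [|||u' [v' uv']] := @mate_exists (S :\ q) => //.
- exact: chainS S_chain.
- by move=> r /(subsetP S'S); exact: (mate_inner uv).
exists u', v'; split=> //.
have wS : weight S = wt q + weight (S :\ q) by rewrite /weight (big_setD1 q).
have u'_na := mate_nonapex uv'; have wu' : wt u' = m.+1 - row u'.
  by rewrite /wt (negPf u'_na).
have [q_apex|q_na] := boolP (apexp q).
  rewrite wS; apply: leq_ltn_trans (weightU _ _) _; rewrite ltn_add2r wu'.
  by rewrite /wt q_apex; lia.
move: uv uv' => [[vS v_na] [uv uv_row] u_min [a aS [a_apex au]] v_max].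
move=> [[v'S v'_na] [uv' uv'_row] u'_min [b bS [b_apex bu]] v'_max].
have aS' : a \in S :\ q.
  by rewrite !inE aS andbT; apply/eqP => aq; rewrite -aq a_apex in q_na.
have row_u : row u = row u'.
  apply: val_inj; apply/eqP; rewrite eqn_leq -{2}au -{1}bu.
  by rewrite u_min ?u'_min // (subsetP S'S).
have row_v : row v = row v'.
  by apply: val_inj; apply/eqP; rewrite -eqSS -uv_row -uv'_row row_u.
have [qv|qv] := eqVneq q v.
  rewrite wS; apply: leq_ltn_trans (weightU _ _) _; rewrite ltn_add2r wu'.
  by rewrite /wt (negPf q_na) qv -row_u uv_row ltn_sub2l.
have vE : v = v'.
  apply: qle_anti; last by apply: v_max; rewrite ?(subsetP S'S).
  by apply: v'_max; rewrite // !inE eq_sym qv.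
have uE : u' = u.
  by rewrite [u]surjective_pairing [u']surjective_pairing uv uv' vE; congr pair.
rewrite uE (setUidPr _) ?sub1set ?inE ?uS ?andbT 1?eq_sym //.
by rewrite wS -[X in X < _]add0n ltn_add2r wt_gt0.
Qed.

End Matching.

Section InnerStage.
Variables (n m : nat) (C : sset).

Local Notation X := (sprod (cone n) (Delta m)).
Implicit Types (G : subsset (sprod X C)).

Definition closed_mate G :=
  forall k (x : X k) l (y : X l) u v,
    mate (supp x) u v -> sdom G x -> supp y = u |: supp x -> sdom G y.

Lemma sdom_supp G k (x : X k) l (y : X l) :
  supp x \subset supp y -> sdom G y -> sdom G x.
Proof. by move=> /supp_sub_act [f ->]; exact: sdom_act. Qed.

Lemma supp_inj_act k (x : X k) l (t t' : mono l k) :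
  injective (vtx x) -> act t x = act t' x -> t = t'.
Proof.
move=> x_inj tt'; apply: monoP => i; apply: x_inj.
by rewrite -!vtx_act tt'.
Qed.

(** The faces of x other than the one opposite to u are in the domain by
    hypothesis, while the one opposite to u is not, since the closure property
    would put x itself in the domain.  So x meets the domain in a horn; it is
    inner because v comes before u and an apex vertex after it. *)
Lemma glue_horn G k (x : X k) u v :
  quasicategory C -> functional G -> closed_mate G -> injective (vtx x) ->
  u \in supp x -> mate (supp x) u v -> ~ sdom G x ->
  (forall q, q \in supp x -> q != u ->
     forall l (y : X l), supp y \subset supp x :\ q -> sdom G y) ->
  exists w : C k, functional (glue G x w) /\ closed_mate (glue G x w).
Proof.
move=> C_qcat G_fun G_closed x_inj /imsetP [i _ ui] uv xG x_faces.
have vtx_lt (j j' : 'I_k.+1) :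
    qle (vtx x j) (vtx x j') -> vtx x j != vtx x j' -> j < j'.
  move=> jj' ne; rewrite ltnNge; apply: contra ne => /(vtx_leq x) j'j.
  by apply/eqP/qle_anti.
have i_inner : 0 < i < k.
  have u_na := mate_nonapex uv.
  have [[/imsetP [iv _ viv] v_na] [u1 uv_row] _] := uv.
  move=> [q /imsetP [iq _ qiq] [q_apex qu]] _.
  apply/andP; split.
    apply: leq_ltn_trans (leq0n iv) (vtx_lt _ _ _ _); rewrite -ui -viv.
      by rewrite /qle u1 !leqnn -/(row v) -/(row u) uv_row /=.
    by apply/eqP => vu; move: uv_row; rewrite vu; lia.
  suff /leq_trans : i < iq by apply; rewrite -ltnS.
  have ne : u != q by apply/eqP => uq; rewrite uq q_apex in u_na.
  apply: vtx_lt; rewrite -ui -qiq //.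
  have /orP [] := supp_chain (mem_supp x i) (mem_supp x iq);
    rewrite -ui -qiq // => qu'.
  by rewrite (apexp_mono qu' q_apex) in u_na.
have hornG l (t : Delta k l) : horn i l t -> sdom G (act t x).
  case=> j [ji tj]; apply: (x_faces (vtx x j)); first exact: mem_supp.
    by rewrite ui; apply: contra ji => /eqP /x_inj ->.
  apply/subsetP => _ /imsetP [a _ ->]; rewrite vtx_act !inE mem_supp andbT.
  by apply: contra (tj a) => /eqP /x_inj ->.
have not_horn l (t : Delta k l) :
    ~ horn i l t -> supp x :\ u \subset supp (act t x).
  move=> t_full; apply/subsetP => q /setD1P [ju /imsetP [j _ jE]].
  have [a ta] : exists a, t a = j.
    apply: contra_notP t_full => no_a; exists j; split.
      by apply/eqP => ji; rewrite jE ui ji eqxx in ju.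
    by move=> a; apply/eqP => ta; apply: no_a; exists a.
  by rewrite jE -ta -vtx_act mem_supp.
have ux : u \in supp x by rewrite ui mem_supp.
have horn_dom l (t : Delta k l) : sdom G (act t x) -> horn i l t.
  move=> tG; apply: contrapT => /not_horn t_big; apply: xG.
  apply: (G_closed _ (act t x) _ _ u v) => //.
    apply: mate_between uv => //.
    exact: subset_trans (supp_act _ _) (subsetUr _ _).
  apply/eqP; rewrite eqEsubset; apply/andP; split.
    apply/subsetP => q qx; rewrite !inE; case: eqVneq => //= qu.
    by apply: (subsetP t_big); rewrite !inE qu.
  by rewrite subUset sub1set ux; exact: supp_act.
have [w wP] := horn_fill C_qcat G_fun i_inner hornG.
exists w; split.
  apply: glue_functional => // l t; first by move=> /horn_dom/wP.
  by move=> t' _; exact: supp_inj_act.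
move=> l y l' y' u' v' uv' [c [Gc|[t [yE _]]]] y'E.
  apply: sdom_sle (@sle_glue _ _ G _ x w) _.
  by apply: (G_closed _ y _ y' u' v') => //; exists c.
have [ti|/not_horn t_big] := pselect (horn i l t).
  apply: sdom_sle (@sle_glue _ _ G _ x w) _.
  by apply: (G_closed _ y _ y' u' v') => //; rewrite yE; exact: hornG.
have u'E : u' = u.
  apply: mate_uniq uv' _; apply: mate_between uv; rewrite yE //.
  by apply: subset_trans (supp_act _ _) (subsetUr _ _).
have [s ->] : exists s, y' = act s x.
  apply: supp_sub_act; rewrite y'E u'E subUset sub1set ux yE; exact: supp_act.
by apply: sdom_act; exists w; exact: glue_mem.
Qed.

(** In a maximal extension, a simplex of least weight among those that contain
    their mate and are not in the domain has all its faces, except the one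
    opposite to the mate, in the domain, so it could be attached.  Any other
    simplex with support in inner_supp is a face of one that contains its
    mate. *)
Lemma inner_stage G0 :
  quasicategory C -> functional G0 ->
  (forall k (x : X k), sdom G0 x <-> misses (supp x)) ->
  exists G, [/\ functional G, sle G0 G &
    forall k (x : X k), sdom G x <-> inner_supp (supp x)].
Proof.
move=> C_qcat G0_fun G0_dom.
pose P G := [/\ functional G,
  (forall k (x : X k), sdom G x -> inner_supp (supp x)) & closed_mate G].
have [|F F_chain FG0 F_P|G [[G_fun G_inner G_closed] G0G G_max]] :=
  @subsset_zorn _ P G0.
- split=> // [k x /G0_dom|]; first by left.
  move=> k x l y u v uv /G0_dom xm yE; apply/G0_dom; rewrite yE.
  exact: mate_misses uv xm.
- split; first by apply: union_functional => // G /F_P [].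
    by move=> k x [c [G /F_P [_ G_inner _] Gc]]; apply: G_inner; exists c.
  move=> k x l y u v uv [c [G FG Gc]] yE; have [_ _ G_closed] := F_P _ FG.
  have [|c' Gc'] := G_closed _ _ _ _ _ _ uv _ yE; first by exists c.
  by exists c', G.
exists G; split=> // k x; split; first exact: G_inner.
have missG l (y : X l) : misses (supp y) -> sdom G y.
  by move=> /G0_dom; exact: sdom_sle.
have full_enough l (y : X l) u v S : mate S u v -> chainp S -> validp S ->
    supp y \subset S -> ~ misses S ->
    (forall l' (z : X l'), injective (vtx z) -> supp z = u |: S -> sdom G z) ->
    sdom G y.
  move=> uv S_chain S_valid yS S_full zG.
  have [|l' [z [z_inj zE]]] :=
    chain_simplex (mate_chain S_chain uv) (mate_valid S_valid uv).
    by apply/set0Pn; exists u; rewrite !inE eqxx.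
  apply: (@sdom_supp _ _ _ _ z); last exact: zG.
  by rewrite zE; apply: subset_trans yS (subsetUr _ _).
suff main N : forall k (x : X k) u v, injective (vtx x) -> u \in supp x ->
    mate (supp x) u v -> ~ misses (supp x) -> weight (supp x) < N -> sdom G x.
  case=> [|x_inner]; first exact: missG.
  have [|x_full] := pselect (misses (supp x)); first exact: missG.
  have x_chain := @supp_chain _ _ _ x.
  have [u [v uv]] := mate_exists x_chain x_full x_inner.
  apply: (full_enough _ _ u v (supp x)) => // [|l z z_inj zE].
    exact: supp_valid.
  apply: (main (weight (supp z)).+1 _ _ u v) => //; rewrite zE ?setU11 //.
    apply: mate_between uv => //.
    exact: subset_trans (subsetDl _ _) (subsetUr _ _).
  by move=> /(misses_sub (subsetUr _ _)).
elim: N => // N IHN {}k {}x u v x_inj ux uv x_full; rewrite ltnS => wx.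
apply: contrapT => xG.
have x_inner : inner_supp (supp x) by right; exact: mate_inner uv.
have faces q : q \in supp x -> q != u -> forall l (y : X l),
    supp y \subset supp x :\ q -> sdom G y.
  move=> qx qu l y yq; have [|q_full] := pselect (misses (supp x :\ q)).
    by move=> /(misses_sub yq)/missG.
  have x_chain := @supp_chain _ _ _ x.
  have [u' [v' [uv' w_lt]]] := mate_face_weight x_chain uv qx ux qu q_full.
  apply: (full_enough _ _ u' v' (supp x :\ q)) => // [||l' z z_inj zE].
  - exact: chainS (subsetDl _ _) x_chain.
  - exact: validS (subsetDl _ _) (@supp_valid _ _ _ x).
  apply: (IHN _ _ u' v') => //; rewrite zE ?setU11 //.
  - apply: mate_between uv' => //.
    exact: subset_trans (subsetDl _ _) (subsetUr _ _).
  - by move=> /(misses_sub (subsetUr _ _)).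
  - exact: leq_trans w_lt wx.
have [w [H_fun H_closed]] :=
  glue_horn C_qcat G_fun G_closed x_inj ux uv xG faces.
apply: xG; exists w; apply: (G_max (glue G x w)); last exact: glue_mem.
  split=> //.
  move=> l y [c [Gc|[t [-> _]]]]; first by apply: G_inner; exists c.
  exact: inner_supp_sub (supp_act _ _) x_inner.
exact: sle_glue.
Qed.

End InnerStage.

(** * Cones over the first row *)

Definition height_map n : smap (cone n) (Delta n) :=
  @SMap (cone n) (Delta n) (fun _ s => height s)
    (fun _ _ f s => height_act f s).

Lemma cone_map_comp n k l (g : mono l n) (f : mono k l) i (y : cone k i) :
  cone_map (compm g f) i y = cone_map g i (cone_map f i y).
Proof. by rewrite (jptE y) !jpt_map. Qed.

Lemma base_cone_map n k (f : mono k n) i (y : cone k i) :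
  base n i (cone_map f i y) = base k i y.
Proof. by rewrite {1}(jptE y) jpt_map base_jpt. Qed.

Lemma cone_bd_face k l (y : cone k.+1 l) (j : 'I_k.+2) :
  (forall i, apex (base _ _ y) i -> height y i != j) ->
  y = cone_map (face j) l (cone_map (collapse j) l y).
Proof.
move=> yj; rewrite -cone_map_comp; apply: jpt_eq => [|i ap].
  by rewrite base_cone_map.
rewrite [in RHS](jptE y) jpt_map height_jpt ap.
by rewrite -[RHS]/(face j (collapse j (height y i))) collapseK // yj.
Qed.

Section Cell.
Variables (n m : nat) (C : sset) (sq : smap Jsq C).

Local Notation X := (sprod (cone n) (Delta m)).
Local Notation W := (sprod (Delta m) (Delta n)).
Local Notation S := (slice (smap_comp sq res_incl)).

(** The simplices of (I * Delta[n]) x Delta[m] whose span part stays in row 0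
    form a copy of the join of I with Delta[m] x Delta[n]; this is its
    restriction to a simplex s of the latter. *)
Definition row_cone k (s : W k) : smap (cone k) X :=
  spair (cone_map (s.2 : mono k n))
        (smap_comp (height_map m) (cone_map (s.1 : mono k m))).

Lemma row_cone_jpt k (s : W k) l (b : Jsq l) (z : mono l k) :
  row_cone s l (jpt b z) =
  (jpt b (compm (s.2 : mono k n) z), height (jpt b (compm (s.1 : mono k m) z))).
Proof. by rewrite -!jpt_map. Qed.

Lemma row_cone_act k k' (g : mono k k') (s : W k') l (y : cone k l) :
  row_cone (act g s) l y = row_cone s l (cone_map g l y).
Proof. by rewrite (jptE y) jpt_map !row_cone_jpt. Qed.

Lemma vtx_row_cone k (s : W k) l (y : cone k l) i :
  vtx (row_cone s l y) i =
  ((base _ _ y).1 i, (base _ _ y).2 i,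
   if apex (base _ _ y) i then (s.2 : mono k n) (height y i) else ord0,
   if apex (base _ _ y) i then (s.1 : mono k m) (height y i) else ord0).
Proof. by rewrite {1}(jptE y) row_cone_jpt /vtx base_jpt !height_jpt. Qed.

Lemma supp_row_cone_apex k (s : W k) l (y : cone k l) i :
  apexp (vtx (row_cone s l y) i) = apex (base _ _ y) i.
Proof. by rewrite vtx_row_cone. Qed.

Lemma row_row_cone k (s : W k) l (y : cone k l) i :
  row (vtx (row_cone s l y) i) =
  if apex (base _ _ y) i then (s.1 : mono k m) (height y i) else ord0.
Proof. by rewrite vtx_row_cone. Qed.

Lemma height_row_cone k (s : W k) l (y : cone k l) i :
  height_of (vtx (row_cone s l y) i) =
  if apex (base _ _ y) i then (s.2 : mono k n) (height y i) else ord0.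
Proof. by rewrite vtx_row_cone. Qed.

(** If s avoids a row or a column, then so does the apex part of the cone; and
    a surjective monotone map starts at 0. *)
Lemma inner_supp_row_cone k (s : W k) l (y : cone k l) :
  ~ inner_supp (supp (row_cone s l y)) ->
  [/\ surj (s.1 : mono k m), surj (s.2 : mono k n),
      (s.1 : mono k m) ord0 = ord0 & (s.2 : mono k n) ord0 = ord0].
Proof.
move=> y_high.
have surj1 : surj (s.1 : mono k m).
  move=> i; apply: contra_notP y_high => s_i.
  have ri j : (s.1 : mono k m) j != i by apply/eqP => sj; apply: s_i; exists j.
  have [i0|i0] := eqVneq i ord0.
    right=> _ /imsetP [j _ ->]; rewrite supp_row_cone_apex => ap.
    by rewrite row_row_cone ap -i0.
  left; left; exists i => _ /imsetP [j _ ->].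
  by rewrite row_row_cone; case: ifP => // _; rewrite eq_sym.
have surj2 : surj (s.2 : mono k n).
  move=> i; apply: contra_notP y_high => s_i; left; right.
  exists i => _ /imsetP [j _ ->]; rewrite supp_row_cone_apex => ap.
  rewrite height_row_cone ap; apply/eqP => sj; apply: s_i.
  by exists (height y j).
have surj0 N (f : mono k N) : surj f -> f ord0 = ord0.
  move=> f_surj; have [i fi] := f_surj ord0; apply: val_inj; apply/eqP.
  by rewrite -leqn0 -[X in _ <= X]/(val (@ord0 N)) -fi mono_leq.
by split=> //; exact: surj0.
Qed.

(** The prescribed values of the cone over s are on cones over proper faces of
    s. *)
Lemma inner_supp_missed k (s : W k) l (y : cone k l) :
  surj (s.1 : mono k m) -> surj (s.2 : mono k n) ->
  (s.1 : mono k m) ord0 = ord0 ->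
  inner_supp (supp (row_cone s l y)) ->
  exists j, forall i, apex (base _ _ y) i -> height y i != j.
Proof.
move=> surj1 surj2 s0 [[[r yr]|[c yc]]|y0].
- have [j sj] := surj1 r; exists j => i ap; apply/eqP => yj.
  by have := yr _ (mem_supp _ i); rewrite row_row_cone ap yj sj eqxx.
- have [j sj] := surj2 c; exists j => i ap; apply/eqP => yj.
  have := yc _ (mem_supp _ i).
  by rewrite supp_row_cone_apex height_row_cone ap yj sj eqxx => /(_ isT).
- exists ord0 => i ap; apply/eqP => yj.
  have := y0 _ (mem_supp _ i).
  by rewrite supp_row_cone_apex row_row_cone ap yj s0 eqxx => /(_ isT).
Qed.

Variable G : subsset (sprod X C).
Hypothesis G_fun : functional G.
Hypothesis G_inner : forall k (x : X k), sdom G x <-> inner_supp (supp x).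
Hypothesis G_sq : forall l (b : Jsq l),
  G l ((jpt b (constm l ord0), constm l ord0 : Delta m l), sq l b).

Lemma agree_act k k' (g : mono k k') (z : sprod W S k') :
  (forall l y c, G l (row_cone z.1 l y, c) -> sval z.2 l y = c) ->
  (forall l y c, G l (row_cone (act g z).1 l y, c) -> sval (act g z).2 l y = c).
Proof. by move=> zG l y c; rewrite row_cone_act => /zG. Qed.

(** The simplices of the slice that are allowed over a simplex s of Delta[m] x
    Delta[n]: the cones that extend the given values. *)
Definition agree : subsset (sprod W S) := SubSSet agree_act.

Lemma row_cone_inl k (s : W k) l (x : Isp l) :
  G l (row_cone s l (join_inl Isp (Delta k) l x), sq l (sval x)).
Proof.
have nap i : ~~ apex (sval x) i by move/apex_IspanP: (proj2_sig x).
rewrite (jpt_inl x (constm l ord0)) row_cone_jpt.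
have -> : jpt (sval x) (compm (s.2 : mono k n) (constm l ord0)) =
          jpt (sval x) (constm l ord0).
  by apply: jpt_eq => [|i]; rewrite !base_jpt // (negPf (nap i)).
have -> : height (jpt (sval x) (compm (s.1 : mono k m) (constm l ord0))) =
          constm l ord0.
  by apply: monoP => i; rewrite height_jpt (negPf (nap i)).
exact: G_sq.
Qed.

Lemma agree_inside k (s : W k) (e : smap (ssub (boundary k)) S) :
  (forall l (t : ssub (boundary k) l), agree l (act (sval t) s, e l t)) ->
  (forall l y, sdom G (row_cone s l y)) ->
  exists2 y : S k, agree k (s, y) &
    forall l (t : ssub (boundary k) l), act (sval t) y = e l t.
Proof.
move=> eA sG; have [u uP] := pullback_total G_fun sG.
have up : smap_comp u (join_inl Isp (Delta k)) = smap_comp sq res_incl.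
  by apply: smapP => l x; apply: G_fun (uP _ _) (row_cone_inl s x).
exists (exist _ u up) => [l y c /= yc|l t]; first exact: G_fun (uP l y) yc.
case E: (e l t) => [v vp]; apply: eq_exist; apply: smapP => i y /=.
have := eA l t i y (u i (cone_map (sval t) i y)).
by rewrite row_cone_act E => yE; apply/esym/yE/uP.
Qed.

(** Unless the values of the cone over s are all prescribed, s is surjective
    and starts at (0, 0).  Then it has positive dimension, the sphere to be
    filled has the pushout square as first vertex, and that is an initial
    vertex of the slice.  The filler has the prescribed values, because these
    are given on cones over faces of s only. *)
Lemma agree_fill k (s : W k) (e : smap (ssub (boundary k)) S) :
  0 < m + n -> pushout_square sq ->
  (forall l (t : ssub (boundary k) l), agree l (act (sval t) s, e l t)) ->
  exists2 y : S k, agree k (s, y) &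
    forall l (t : ssub (boundary k) l), act (sval t) y = e l t.
Proof.
move=> mn_gt0 sq_po eA.
have [/(agree_inside eA) //|] := pselect (forall l y, sdom G (row_cone s l y)).
move=> /existsNP [l0 /existsNP [y0 /G_inner /inner_supp_row_cone]].
move=> {l0 y0} [surj1 surj2 s1 s2].
case: k s e eA surj1 surj2 s1 s2 => [|k] s e eA surj1 surj2 s1 s2.
  have all0 N (f : mono 0 N) : surj f -> f ord0 = ord0 -> N = 0.
    move=> f_surj f0; have [i fi] := f_surj ord_max.
    by have := congr1 val fi; rewrite ord1 f0.
  have m0 := all0 _ _ surj1 s1; have n0 := all0 _ _ surj2 s2.
  by exfalso; move: mn_gt0; rewrite addn_gt0 lt0n m0 lt0n n0.
have e0 : e 0 (bd_vertex0 k) = sq_cone sq.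
  have := eA 0 (bd_vertex0 k).
  case: (e 0 _) => [v vp] vG; apply: eq_exist; apply: smapP => l y.
  have yE : sval (sq_cone sq) l y = sq l (base 0 l y).
    by rewrite {1}(jptE y) sq_cone_jpt.
  apply: etrans (vG l y (sq l (base 0 l y)) _) (esym yE).
  rewrite {1}(jptE y) row_cone_jpt.
  have -> : compm ((act (sval (bd_vertex0 k)) s).2 : mono 0 n) (height y) =
            constm l ord0 by apply: monoP.
  have -> : height (jpt (base 0 l y)
      (compm ((act (sval (bd_vertex0 k)) s).1 : mono 0 m) (height y))) =
      constm l ord0.
    by apply: monoP => i; rewrite height_jpt /= s1; case: ifP.
  exact: G_sq.
have [t te] := sq_po k e e0.
have tE l (a : ssub (boundary k.+1) l) : act (sval a) (t k.+1 (idm _)) = e l a.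
  by rewrite -smap_nat -te.
exists (t k.+1 (idm _)) => // l y c yc.
have y_inner : inner_supp (supp (row_cone s l y)) by apply/G_inner; exists c.
have [j /cone_bd_face yE] := inner_supp_missed surj1 surj2 s1 y_inner.
have jbd : boundary k.+1 k (face j) by exists j => i; exact: face_neq.
have := eA _ (exist _ (face j) jbd) l (cone_map (collapse j) l y) c.
by rewrite row_cone_act -yE => /(_ yc) <-; rewrite -tE {1}yE.
Qed.

(** The apex part of x is prolonged over the other vertices by (0, 0), which
    is its value there, so that it becomes a simplex of the same dimension as
    x. *)
Lemma row_cone_self l (x : X l) :
  (forall i, ~~ apex (base n l x.1) i -> (x.2 : mono l m) i = ord0) ->
  row_cone (x.2, height x.1) l (jpt (base n l x.1) (idm l)) = x.
Proof.
move=> x_row; rewrite row_cone_jpt [RHS]surjective_pairing; congr pair.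
  by rewrite [RHS]jptE.
apply: monoP => i; rewrite height_jpt.
by case: ifP => // /negbT /x_row ->.
Qed.

Lemma extend_act (h : smap W S) k l (f : mono k l) (z : sprod X C l) :
  G l z \/
    (forall i, ~~ apex (base n l z.1.1) i -> (z.1.2 : mono l m) i = ord0) /\
    z.2 = sval (h l (z.1.2, height z.1.1)) l (jpt (base n l z.1.1) (idm l)) ->
  G k (act f z) \/
  (forall i, ~~ apex (base n k (act f z).1.1) i ->
     ((act f z).1.2 : mono k m) i = ord0) /\
  (act f z).2 = sval (h k ((act f z).1.2, height (act f z).1.1)) k
                  (jpt (base n k (act f z).1.1) (idm k)).
Proof.
case: z => -[y r] c [|[x_row c_h]]; first by left; exact: smem_act.
right; change ((forall i, ~~ apex (base n k (act f y)) i -> r (f i) = ord0) /\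
  act f c = sval (h k (compm r f : Delta m k, height (act f y))) k
              (jpt (base n k (act f y)) (idm k))).
rewrite height_act -[(_, compm _ _)]/(act f ((r, height y) : W l)).
rewrite smap_nat [h k _]smap_nat; split=> [i /x_row //|].
change (c = sval (h l (r, height y)) l (jpt (base n l y) (idm l))) in c_h.
rewrite c_h -smap_nat jpt_act.
change (sval (h l (r, height y)) k (jpt (act f (base n l y)) f) =
  sval (h l (r, height y)) k (cone_map f k (jpt (act f (base n l y)) (idm k)))).
by rewrite jpt_map.
Qed.

(** By row_cone_self, a simplex with span part in row 0 is a simplex of a
    cone over a simplex of W, which has a value by h. *)
Definition extend (h : smap W S) : subsset (sprod X C) :=
  SubSSet (extend_act (h := h)).

(** The cones over all simplices of Delta[m] x Delta[n] give values on the
    simplices with span part in row 0, and G is defined on all the others. *)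
Lemma outer_stage :
  0 < m + n -> pushout_square sq ->
  exists u : smap X C, forall k (x : X k) c, G k (x, c) -> u k x = c.
Proof.
move=> mn_gt0 sq_po.
have [k s e|h hA] := @skeletal_lift W S agree; first exact: agree_fill.
have ext_fun : functional (extend h).
  have mix k x c c' : G k (x, c) -> extend h k (x, c') -> c = c'.
    move=> Gc [Gc'|[x_row /= ->]]; first exact: G_fun Gc Gc'.
    by apply/esym/hA; rewrite row_cone_self.
  move=> k x c c' [Gc|Ec] Ec'; first exact: mix Gc Ec'.
  case: Ec' => [Gc'|Ec']; first by apply/esym/(mix _ _ _ _ Gc'); right.
  by case: Ec => _ /= ->; case: Ec' => _ /= ->.
have [k x|u uE] := @pullback_total X X C (extend h) (smap_id X) ext_fun.
  have [/G_inner [c Gc]|x_high] := pselect (inner_supp (supp x)).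
    by exists c; left.
  exists (sval (h k (x.2, height x.1)) k (jpt (base n k x.1) (idm k))).
  right; split=> //.
  move=> i nap.
  (* The vertices in the span precede an apex vertex that is in row 0. *)
  have [j [ap row0]] : exists j, apexp (vtx x j) /\ row (vtx x j) = ord0.
    apply: contra_notP x_high => no_j; right=> _ /imsetP [j _ ->] ap.
    by apply/eqP => row0; apply: no_j; exists j.
  have [ij|/ltnW ji] := leqP i j.
    apply: val_inj; apply/eqP; rewrite -leqn0.
    have /and4P [_ _ _] := vtx_leq x ij; by rewrite [(vtx x j).2]row0.
  move: nap; rewrite -[apex _ i]/(apexp (vtx x i)).
  by rewrite (apexp_mono (vtx_leq x ji) ap).
by exists u => k x c Gc; apply: ext_fun (uE k x) _; left.
Qed.

End Cell.

(** The extension property of a family of cones over a single simplex.  When m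
    = n = 0 the pushout square would have to be found rather than used; in all
    other cases it lies over the vertex (0, 0) in the part that is given. *)
Lemma cell_extension n m (C : sset) (sq : smap Jsq C)
  (G : subsset (sprod (sprod (cone n) (Delta m)) C)) :
  quasicategory C -> 0 < m + n -> pushout_square sq -> functional G ->
  (forall k (x : sprod (cone n) (Delta m) k), sdom G x <-> misses (supp x)) ->
  (forall l (b : Jsq l),
     G l ((jpt b (constm l ord0), constm l ord0 : Delta m l), sq l b)) ->
  exists u : smap (sprod (cone n) (Delta m)) C,
    forall k x c, G k (x, c) -> u k x = c.
Proof.
move=> C_qcat mn_gt0 sq_po G_fun G_dom G_sq.
have [H [H_fun GH H_dom]] := inner_stage C_qcat G_fun G_dom.
have [|u uH] := outer_stage H_fun H_dom _ mn_gt0 sq_po.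
  by move=> l b; exact/GH/G_sq.
by exists u => k x c /GH; exact: uH.
Qed.

(** * Families of cones *)

(** The join of I with the boundary of Delta[n], inside I * Delta[n]. *)
Definition cone_bd n k (y : cone n k) :=
  exists j, forall i, apex (base n k y) i -> height y i != j.

Lemma misses_suppP n m k (x : sprod (cone n) (Delta m) k) :
  misses (supp x) <-> boundary m k x.2 \/ cone_bd x.1.
Proof.
split=> [] [[j xj]|[j xj]].
- left; exists j => i; exact: xj _ (mem_supp x i).
- right; exists j => i ap; exact: xj _ (mem_supp x i) ap.
- by left; exists j => _ /imsetP [i _ ->]; exact: xj.
- by right; exists j => _ /imsetP [i _ ->]; exact: xj.
Qed.

Definition cone_J n : smap Jsq (cone n) :=
  @SMap Jsq (cone n) (fun k b => jpt b (constm k ord0))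
    (fun k l f b => esym (jpt_act f b (constm l ord0))).

Section Family.
Variables (C K : sset) (N : nat) (beta : subsset (sprod (sprod K (cone N)) C)).
Hypothesis C_qcat : quasicategory C.
Hypothesis beta_fun : functional beta.
Hypothesis beta_dom : forall k (x : sprod K (cone N) k),
  sdom beta x <-> cone_bd x.2.

Definition square_at m (e : sexp (cone N) C m) (i : 'I_m.+1) : smap Jsq C :=
  vertex_map (act (constm 0 i) (sexp_pre C (cone_J N) m e)).

Lemma square_atE m (e : sexp (cone N) C m) i k (b : Jsq k) :
  square_at e i k b = e k (jpt b (constm k ord0), constm k i).
Proof. by []. Qed.

(** A family of cones with the prescribed values.  That its squares be
    pushouts is kept along the construction, since the one over the vertex 0
    serves to extend the family to the next dimension. *)
Definition good_cone m (z : sprod K (sexp (cone N) C) m) :=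
  (forall k (y : cone N k) (g : mono k m) c,
     beta k ((act g z.1, y), c) -> (z.2 : smap _ _) k (y, g : Delta m k) = c) /\
  (forall i, pushout_square (square_at z.2 i)).

Lemma good_cone_act m m' (f : mono m m') (z : sprod K (sexp (cone N) C) m') :
  good_cone z -> good_cone (act f z).
Proof.
case=> z_beta z_po; split=> [k y g c|i].
  by rewrite -[(act f z).1]/(act f z.1) -act_comp => /z_beta.
suff -> : square_at (act f z).2 i = square_at z.2 (f i) by exact: z_po.
apply: smapP => k b; rewrite !square_atE.
rewrite -[LHS]/((z.2 : smap _ _) k (_, compm f (constm k i))).
by congr ((z.2 : smap _ _) k (_, _)); apply: monoP.
Qed.

Definition good : subsset (sprod K (sexp (cone N) C)) := SubSSet good_cone_act.

Section Sphere.
Variables (m : nat) (x : K m) (e : smap (ssub (boundary m)) (sexp (cone N) C)).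
Hypothesis e_good : forall k (t : ssub (boundary m) k),
  good k (act (sval t) x, e k t).

Lemma sphere_act k l (f : mono k l) (z : sprod (sprod (cone N) (Delta m)) C l) :
  beta l ((act (z.1.2 : mono l m) x, z.1.1), z.2) \/
  (exists2 t : ssub (boundary m) l, sval t = z.1.2 &
     (e l t : smap _ _) l (z.1.1, idm l : Delta l l) = z.2) ->
  beta k ((act ((act f z).1.2 : mono k m) x, (act f z).1.1), (act f z).2) \/
  (exists2 t : ssub (boundary m) k, sval t = (act f z).1.2 &
     (e k t : smap _ _) k ((act f z).1.1, idm k : Delta k k) = (act f z).2).
Proof.
case=> [/(smem_act f)|[t tE ez]]; first by left; rewrite act_comp.
right; exists (act f t); first by rewrite /= tE.
by rewrite -[RHS]/(act f z.2) -ez -[RHS]smap_nat [e k _]smap_nat.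
Qed.

(** The values prescribed by beta over x, together with those of the family e
    over the boundary of Delta[m]. *)
Definition sphere : subsset (sprod (sprod (cone N) (Delta m)) C) :=
  SubSSet sphere_act.

Lemma sphere_functional : functional sphere.
Proof.
have mix k (y : cone N k) (g : Delta m k) c (t : ssub (boundary m) k) :
    sval t = g -> beta k ((act (g : mono k m) x, y), c) ->
    (e k t : smap _ _) k (y, idm k : Delta k k) = c.
  move=> <- yc; have [t_beta _] := e_good t.
  by apply: t_beta; rewrite act_id.
move=> k [y g] c c' [/= yc|[t tg /= <-]] [/= yc'|[t' t'g /= <-]].
- exact: beta_fun yc yc'.
- by apply/esym; exact: mix t'g yc.
- exact: mix tg yc'.
- suff -> : t = t' by [].
  by apply: sval_inj; exact: etrans tg (esym t'g).
Qed.

Lemma sphere_dom k (z : sprod (cone N) (Delta m) k) :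
  sdom sphere z <-> misses (supp z).
Proof.
rewrite misses_suppP; split.
  case=> c [yc|[t tz _]]; last by left; rewrite -[z.2]tz; exact: proj2_sig t.
  by right; apply/(beta_dom (act (z.2 : mono k m) x, z.1)); exists c.
case=> [zb|/(beta_dom (act (z.2 : mono k m) x, z.1)) [c yc]].
  exists ((e k (exist _ z.2 zb) : smap _ _) k (z.1, idm k : Delta k k)).
  by right; exists (exist _ z.2 zb).
by exists c; left.
Qed.

Lemma sphere_fill (sq : smap Jsq C) :
  0 < m + N -> pushout_square sq ->
  (forall l (b : Jsq l),
     sphere l ((jpt b (constm l ord0), constm l ord0 : Delta m l), sq l b)) ->
  exists2 u : sexp (cone N) C m, good m (x, u) &
    forall k (t : ssub (boundary m) k), act (sval t) u = e k t.
Proof.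
move=> mN sq_po sq_sphere.
have [u uE] :=
  cell_extension C_qcat mN sq_po sphere_functional sphere_dom sq_sphere.
have u_bd k (t : ssub (boundary m) k) :
    act (sval t) (u : sexp (cone N) C m) = e k t.
  apply: smapP => l [y g]; apply: uE; right; exists (act g t) => //.
  by rewrite smap_nat.
exists (u : sexp (cone N) C m) => //; split=> [k y g c yc|i].
  by apply: uE; left.
have [->|i0] := eqVneq i ord0.
  suff -> : square_at (u : sexp (cone N) C m) ord0 = sq by [].
  by apply: smapP => l b; rewrite square_atE; exact: uE.
(* Over a vertex other than 0 the square is the one of the family e. *)
have ib : boundary m 0 (constm 0 i) by exists ord0.
have [_ /(_ ord0)] := @e_good 0 (exist _ (constm 0 i) ib).
suff -> : square_at (u : sexp (cone N) C m) i =
          square_at (e 0 (exist _ (constm 0 i) ib)) ord0.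
  by [].
by rewrite -u_bd; apply: smapP.
Qed.

End Sphere.

(** For N = 0 this turns a choice of pushouts at the vertices of K into a
    coherent one; for N > 0 it extends a family of spheres to a family of
    simplices under the span. *)
Lemma family_extension :
  (forall x : K 0, exists e, good 0 (x, e)) ->
  exists u : smap K (sexp (cone N) C), forall m x, good m (x, u m x).
Proof.
move=> good0; apply: skeletal_lift => [] [|m] x e e_good.
  have [u u_good] := good0 x; exists u => // k t.
  by case: (boundary0_empty (proj2_sig t)).
have bd0 : boundary m.+1 0 (constm 0 ord0) by exists ord_max.
(* In positive dimension the vertex 0 lies in the boundary, where the family
   is already given. *)
have [_ /(_ ord0) po] := e_good 0 (exist _ (constm 0 ord0) bd0).
apply: sphere_fill po _ => // l b; right.
exists (act (constm l ord0)
  (exist _ (constm 0 ord0) bd0 : ssub (boundary m.+1) 0)) => //.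
by rewrite smap_nat.
Qed.

(** Over a vertex, the pushout square has to come from beta. *)
Lemma vertex_extension (x : K 0) (sq : smap Jsq C) :
  0 < N -> pushout_square sq ->
  (forall l (b : Jsq l),
     beta l ((act (constm l ord0) x, jpt b (constm l ord0)), sq l b)) ->
  exists e, good 0 (x, e).
Proof.
move=> N_gt0 sq_po sq_beta.
have e_fun k (t : ssub (boundary 0) k) : False.
  exact: boundary0_empty (proj2_sig t).
pose e : smap (ssub (boundary 0)) (sexp (cone N) C) :=
  @SMap _ (sexp (cone N) C) (fun k t => match e_fun k t with end)
    (fun k l f t => match e_fun l t with end).
have [k t|l b|u u_good _] := @sphere_fill 0 x e _ sq N_gt0 sq_po.
- by case: (e_fun k t).
- by left; exact: sq_beta.
- by exists u.
Qed.

End Family.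

(** * Functorial choices of pushouts *)

Section Choice.
Variables (C : sset) (cof : C 1 -> Prop).

Lemma span_values_act k l (f : mono k l)
  (z : sprod (sprod (CI_co cof) (cone 0)) C l) :
  (exists2 x : Isp l, base 0 l z.1.2 = sval x &
     z.2 = (sval z.1.1 : smap _ _) l (x, idm l : Delta l l)) ->
  exists2 x : Isp k, base 0 k (act f z).1.2 = sval x &
     (act f z).2 = (sval (act f z).1.1 : smap _ _) k (x, idm k : Delta k k).
Proof.
case: z => -[d y] c [x yx cx]; exists (act f x).
  exact: etrans (smap_nat (base 0) f y) (congr1 (act f) yx).
by apply: etrans (congr1 (act f) cx) _; rewrite -smap_nat.
Qed.

(** The tautological family of spans, indexed by the simplices of CI_co cof,
    as a partial map with values over I inside I * Delta[0]. *)
Definition span_values : subsset (sprod (sprod (CI_co cof) (cone 0)) C) :=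
  SubSSet span_values_act.

Lemma span_values_functional : functional span_values.
Proof.
move=> k [d y] c c' [x yx cx] [x' yx' cx'].
suff xx' : x = x' by rewrite [c]cx [c']cx' xx'.
by apply: sval_inj; exact: etrans (esym yx) yx'.
Qed.

Lemma span_values_dom k (z : sprod (CI_co cof) (cone 0) k) :
  sdom span_values z <-> cone_bd z.2.
Proof.
split=> [[c [x zx _]]|[j zj]].
  exists ord0 => i; rewrite [base _ _ _]zx => ap.
  by have /apex_IspanP/(_ i) := proj2_sig x; rewrite ap.
have zI : Ispan k (base 0 k z.2).
  apply/apex_IspanP => i; apply/negP => /zj.
  by rewrite !ord1.
exists ((sval z.1 : smap _ _) k (exist _ _ zI : Isp k, idm k : Delta k k)).
by exists (exist _ _ zI).
Qed.

(** The tautological family of spans extends to a family of squares. *)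
Lemma pushouts_functorial :
  quasicategory C -> admits_pushouts cof ->
  exists F : smap (CI_co cof) (CJ_co_po cof), functorial_choice F.
Proof.
move=> C_qcat C_po.
have [d|u u_good] :=
  family_extension C_qcat span_values_functional span_values_dom.
  have [s sd] := C_po d.
  pose e : sexp (cone 0) C 0 :=
    smap_comp (sval s : smap _ _) (sprod_map (base 0) (smap_id (Delta 0))).
  exists e.
  split=> [k y g c [x /= yx ->]|i].
    rewrite -[LHS]/((sval s : smap _ _) k (base 0 k y, g : Delta 0 k)).
    by rewrite -sd [base _ _ _]yx.
  have [_] := proj2_sig s (idm 0).
  suff -> : square_at e i = vertex_map (act (idm 0) (sval s)) by [].
  apply: smapP => k b; rewrite square_atE.
  rewrite -[LHS]/((sval s : smap _ _) k
    (base 0 k (jpt b (constm k ord0)), constm k i : Delta 0 k)).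
  by rewrite base_jpt act_id ord1.
have F_left n (d : CI_co cof n) k (x : Isp k) (g : mono k n) :
    (u n d : smap _ _) k (jpt (sval x) (constm k ord0), g : Delta n k) =
    (sval d : smap _ _) k (x, g : Delta n k).
  have [d_val _] := u_good n d; apply: d_val.
  by exists x; rewrite // [base _ _ _]base_jpt.
have F_po n (d : CI_co cof n) : forall v : mono 0 n,
    edge_cof cof left_edgeJ (act v (sexp_pre C (cone_J 0) n (u n d))) /\
    pushout_square (vertex_map (act v (sexp_pre C (cone_J 0) n (u n d)))).
  move=> v; split.
    have := proj2_sig d v; rewrite /edge_cof.
    suff -> :
      vertex_map (act v (sexp_pre C (cone_J 0) n (u n d))) 1 left_edgeJ =
      vertex_map (act v (sval d)) 1 left_edgeI by [].
    exact: (F_left n d 1 left_edgeI (compm v (constm 1 ord0))).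
  have [_ /(_ (v ord0))] := u_good n d.
  suff -> : vertex_map (act v (sexp_pre C (cone_J 0) n (u n d))) =
            square_at (u n d) (v ord0).
    by [].
  apply: smapP => k b; rewrite square_atE.
  by congr ((u n d : smap _ _) k (_, _)); apply: monoP => i.
exists (@slift _ _ (full _) (smap_comp (sexp_pre C (cone_J 0)) u) F_po).
apply: smapP => n d; apply: sval_inj; apply: smapP => k [x g].
exact: (F_left n d k x g).
Qed.

End Choice.

(** * Pushouts in exponentials *)

Lemma ev_nat (C K : sset) (x : K 0) m n (f : mono m n) (e : sexp K C n) :
  (act f e : smap _ _) m (act (constm m ord0) x, idm m : Delta m m) =
  act f ((e : smap _ _) n (act (constm n ord0) x, idm n : Delta n n)).
Proof. by rewrite -smap_nat /= -act_comp. Qed.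

Definition ev (C K : sset) (x : K 0) : smap (sexp K C) C :=
  SMap (@ev_nat C K x).

Section Clamp.
Variables (k : nat) (i0 : 'I_k.+1).

Definition clamp_fun (i : 'I_k.+1) := if i <= i0 then i0 else i.

Lemma clamp_leq (i j : 'I_k.+1) : i <= j -> clamp_fun i <= clamp_fun j.
Proof.
rewrite /clamp_fun => ij.
case: (leqP i i0) => [_|i0i]; case: (leqP j i0) => // j0.
- exact: ltnW.
- by have := leq_trans i0i (leq_trans ij j0); rewrite ltnn.
Qed.

Definition clamp : mono k k := Mono clamp_leq.

End Clamp.

(** A simplex of I * Delta[N] can be the image of simplices of several I *
    Delta[l].  If it lies in I, its value is given by p.  Otherwise let i0 be
    its first apex vertex: the heights before i0 being immaterial, they can be
    replaced by the one at i0, after which the simplex of Delta[N] formed by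
    the heights is the same in all descriptions. *)
Lemma slice_value (Y : sset) (p : smap Isp Y) N (T : subsset (Delta N))
  (s : smap (ssub T) (slice p)) l l' (t : ssub T l) (t' : ssub T l') k
  (y : cone l k) (y' : cone l' k) :
  cone_map (sval t : mono l N) k y = cone_map (sval t' : mono l' N) k y' ->
  sval (s l t) k y = sval (s l' t') k y'.
Proof.
rewrite (jptE y) (jptE y').
move: (base _ _ y) (height y) (base _ _ y') (height y') => b z b' z' tt'.
have bb' : b = b'.
  by have := congr1 (base N k) tt'; rewrite !base_cone_map !base_jpt.
case: b' / bb' tt' => tt'.
have [[i1 ap1]|no_ap] := pselect (exists i, apex b i); last first.
  have bI : Ispan k b.
    by apply/apex_IspanP => i; apply/negP => ap; apply: no_ap; exists i.
  pose x : Isp k := exist _ b bI.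
  have val l1 (t1 : ssub T l1) (z1 : mono k l1) :
      sval (s l1 t1) k (jpt b z1) = p k x.
    rewrite -[jpt b z1]/(jpt (sval x) z1) -(jpt_inl x z1).
    exact: (congr1 (fun u : smap Isp Y => u k x) (proj2_sig (s l1 t1))).
  by rewrite !val.
have [i0 ap0 i0_min] := @arg_minnP _ i1 (apex b) val ap1.
have clampK i : apex b i -> clamp i0 i = i.
  move=> api; apply: val_inj; rewrite /= /clamp_fun; case: leqP => // ii0.
  by apply/eqP; rewrite eqn_leq ii0 i0_min.
have ap_clamp i : apex b (clamp i0 i).
  rewrite /= /clamp_fun; case: leqP => // i0i.
  have := @sq_cut_leq _ b i0 i (ltnW i0i); rewrite -!sq_cut_apex in ap0 *.
  rewrite -[sq_cut_fun b i0]/(sq_cut b i0) (eqP ap0) => le_i.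
  apply/eqP/ord2P => i_0; move: le_i.
  by rewrite -[sq_cut_fun b i]/(sq_cut b i) i_0.
have val l1 (t1 : ssub T l1) (z1 : mono k l1) :
    sval (s l1 t1) k (jpt b z1) =
    sval (s k (act (compm z1 (clamp i0)) t1)) k (jpt b (idm k)).
  have -> : jpt b z1 = cone_map (compm z1 (clamp i0)) k (jpt b (idm k)).
    rewrite jpt_map; apply: jpt_eq => [|i]; rewrite !base_jpt // => ap.
    by rewrite !height_jpt ap -[RHS]/(z1 (clamp i0 i)) clampK.
  by rewrite smap_nat.
suff tE : act (compm z (clamp i0)) t = act (compm z' (clamp i0)) t'.
  by rewrite (val _ t z) (val _ t' z') tE.
apply: sval_inj; apply: monoP => i.
have := congr1 (fun y0 => height y0 (clamp i0 i)) tt'.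
by rewrite !jpt_map !height_jpt ap_clamp.
Qed.

Section Objectwise.
Variables (C K : sset) (sq : smap Jsq (sexp K C)) (N : nat).
Variable s : smap (ssub (boundary N.+1)) (slice (smap_comp sq res_incl)).

Lemma sphere_values_act k l (f : mono k l)
  (z : sprod (sprod K (cone N.+1)) C l) :
  (exists l' (t : ssub (boundary N.+1) l') (y : cone l' l),
     z.1.2 = cone_map (sval t : mono l' N.+1) l y /\
     z.2 = (sval (s l' t) l y : smap _ _) l (z.1.1, idm l : Delta l l)) ->
  exists l' (t : ssub (boundary N.+1) l') (y : cone l' k),
     (act f z).1.2 = cone_map (sval t : mono l' N.+1) k y /\
     (act f z).2 =
       (sval (s l' t) k y : smap _ _) k ((act f z).1.1, idm k : Delta k k).
Proof.
case=> l' [t [y [zy zc]]]; exists l', t, (act f y); split.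
  by apply: etrans (congr1 (act f) zy) _; rewrite smap_nat.
apply: etrans (congr1 (act f) zc) _.
by rewrite -[LHS]smap_nat (smap_nat (sval (s l' t)) f y).
Qed.

(** The adjoint form of the sphere s: its values on the product of K with the
    join of I and the boundary of Delta[N.+1]. *)
Definition sphere_values : subsset (sprod (sprod K (cone N.+1)) C) :=
  SubSSet sphere_values_act.

Lemma sphere_values_functional : functional sphere_values.
Proof.
move=> k [x w] c c' [l [t [y [wy cy]]]] [l' [t' [y' [wy' cy']]]].
have E : sval (s l t) k y = sval (s l' t') k y'.
  by apply: slice_value; exact: etrans (esym wy) wy'.
by rewrite [c]cy [c']cy' E.
Qed.

Lemma sphere_values_dom k (z : sprod K (cone N.+1) k) :
  sdom sphere_values z <-> cone_bd z.2.
Proof.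
split.
  case=> c [l [t [y [zy _]]]]; have [j tj] := proj2_sig t.
  exists j => i; rewrite [z.2]zy base_cone_map (jptE y) jpt_map height_jpt.
  rewrite base_jpt => ->; exact: tj.
case=> j zj.
have jbd : boundary N.+1 N (face j) by exists j => i; exact: face_neq.
pose y := cone_map (collapse j) k z.2.
pose t : ssub (boundary N.+1) N := exist _ (face j) jbd.
exists ((sval (s N t) k y : smap _ _) k (z.1, idm k : Delta k k)).
by exists N, t, y; split=> //; exact: cone_bd_face.
Qed.

Hypothesis C_qcat : quasicategory C.
Hypothesis s0 : s 0 (bd_vertex0 N) = sq_cone sq.
Hypothesis sq_po : forall x : K 0, pushout_square (smap_comp (ev C x) sq).

Lemma objectwise_fill :
  exists t : smap (Delta N.+1) (slice (smap_comp sq res_incl)),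
    smap_comp t (sincl (boundary N.+1)) = s.
Proof.
have [x|u u_good] :=
  family_extension C_qcat sphere_values_functional sphere_values_dom.
  apply: (vertex_extension C_qcat sphere_values_functional sphere_values_dom
           _ (@sq_po x)) => // l b.
  exists 0, (bd_vertex0 N), (jpt b (constm l ord0)); split.
    by rewrite -[LHS]/(jpt b (constm l ord0)) jpt_map.
  by rewrite s0 sq_cone_jpt.
have u_val k (x : K k) l (t : ssub (boundary N.+1) l) (y : cone l k)
    (w : cone N.+1 k) :
    w = cone_map (sval t : mono l N.+1) k y ->
    (u k x : smap _ _) k (w, idm k : Delta k k) =
    (sval (s l t) k y : smap _ _) k (x, idm k : Delta k k).
  move=> wy; have [x_val _] := u_good k x; apply: x_val.
  by exists l, t, y; split; rewrite // act_id.
pose f : smap (cone N.+1) (sexp K C) :=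
  vertex_map (swap K (cone N.+1) C 0 (smap_comp u (sfst K (Delta 0)))).
have fE k (w : cone N.+1 k) l (x : K l) (g : mono l k) :
    (f k w : smap _ _) l (x, g : Delta k l) =
    (u l x : smap _ _) l (act g w, idm l : Delta l l) by [].
have f_val k l (t : ssub (boundary N.+1) l) (y : cone l k) :
    f k (cone_map (sval t : mono l N.+1) k y) = sval (s l t) k y.
  by apply: smapP => i [x g]; rewrite fE (u_val _ _ _ t (act g y)) smap_nat.
have fp : smap_comp f (join_inl Isp (Delta N.+1)) = smap_comp sq res_incl.
  apply: smapP => k x; pose t := bd_vertex0 N.
  rewrite -[LHS]/(f k (join_inl Isp (Delta N.+1) k x)).
  have -> : join_inl Isp (Delta N.+1) k x =
      cone_map (sval t : mono 0 N.+1) k (join_inl Isp (Delta 0) k x).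
    by rewrite !(jpt_inl x (constm k ord0)) jpt_map.
  rewrite f_val.
  exact: (congr1 (fun v : smap Isp (sexp K C) => v k x) (proj2_sig (s 0 t))).
exists (simplex_map (exist _ f fp : slice (smap_comp sq res_incl) N.+1)).
apply: smapP => k t; apply: sval_inj; apply: smapP => i y.
exact: (f_val i k t y).
Qed.

End Objectwise.

(** A sphere in the slice of the exponential is a family of spheres in slices
    of C indexed by K; it is filled by extending the family. *)
Lemma objectwise_pushout (C K : sset) (sq : smap Jsq (sexp K C)) :
  quasicategory C -> (forall x : K 0, pushout_square (smap_comp (ev C x) sq)) ->
  pushout_square sq.
Proof. by move=> C_qcat sq_po N s s0; exact: objectwise_fill. Qed.

Section ExpChoice.
Variables (C : sset) (cof : C 1 -> Prop) (K : sset).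
Variable F : smap (CI_co cof) (CJ_co_po cof).
Hypothesis C_qcat : quasicategory C.
Hypothesis F_choice : functorial_choice F.

Local Notation ocof := (objectwise cof (K := K)).

Lemma exp_choiceE n (z : CI_co ocof n) m (w : sprod Jsq (Delta n) m) k
  (x : sprod K (Delta m) k) :
  ((sval (exp_choice K F n z) : smap _ _) m w : smap _ _) k x =
  (sval (F k (unswap_co cof K left_edgeI n z k
      (x.1, compm (w.2 : mono m n) x.2 : Delta n k))) : smap _ _) k
    (act (x.2 : mono k m) w.1, idm k : Delta k k).
Proof. by []. Qed.

(** The value at x of the square chosen for z is the square that F chooses for
    the value of z at x. *)
Lemma exp_choice_po n (z : CI_co ocof n) (v : mono 0 n) :
  edge_cof ocof left_edgeJ (act v (sval (exp_choice K F n z))) /\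
  pushout_square (vertex_map (act v (sval (exp_choice K F n z)))).
Proof.
split; first exact: (proj2_sig (exp_choice K F n z) v).
apply: objectwise_pushout => // x.
pose w := F 0 (unswap_co cof K left_edgeI n z 0 (x, v : Delta n 0)).
have [_] := proj2_sig w (idm 0); rewrite act_id.
suff -> : smap_comp (ev C x) (vertex_map (act v (sval (exp_choice K F n z)))) =
          vertex_map (sval w) by [].
apply: smapP => k b.
have w_nat : F k (unswap_co cof K left_edgeI n z k
      (act (constm k ord0) ((x, v) : sprod K (Delta n) 0))) =
    act (constm k ord0) w by rewrite !smap_nat.
have E := congr1 (fun y : CJ_co_po cof k =>
  (sval y : smap _ _) k (b, idm k : Delta k k)) w_nat.
rewrite -[RHS]E -[LHS]/(((sval (exp_choice K F n z) : smap _ _) k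
  (b, compm v (constm k ord0) : Delta n k) : smap _ _) k
    (act (constm k ord0) x, idm k : Delta k k)).
by rewrite exp_choiceE act_id.
Qed.

Lemma exp_choice_functorial :
  exists G : smap (CI_co ocof) (CJ_co_po ocof),
    smap_comp (CJ_co_po_incl ocof) G = exp_choice K F /\ functorial_choice G.
Proof.
pose G : smap (CI_co ocof) (CJ_co_po ocof) :=
  @slift _ _ (full _) (smap_comp (sincl _) (exp_choice K F)) exp_choice_po.
exists G; split; first by apply: smapP => n z; exact: sval_inj.
apply: smapP => n z; apply: sval_inj.
apply: smapP => l [i g]; apply: smapP => k [x h].
pose w := unswap_co cof K left_edgeI n z k (x, compm g h : Delta n k).
have w_res : res_po cof k (F k w) = w.
  exact: (congr1 (fun u : smap _ _ => u k w) F_choice).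
have E := congr1 (fun y : CI_co cof k =>
  (sval y : smap _ _) k (act h i, idm k : Delta k k)) w_res.
apply: etrans E _.
rewrite -[LHS]/(((sval z : smap _ _) k (act h i, compm g h : Delta n k)
  : smap _ _) k (act (idm k) x, idm k : Delta k k)) act_id.
rewrite -[(act h i, _)]/(act h ((i, g) : sprod Isp (Delta n) l)) smap_nat.
by [].
Qed.

End ExpChoice.

Theorem theorem3p34 (C : sset) (cof : C 1 -> Prop) (K : sset)
  (C_qcat : quasicategory C)
  (cof_id : forall x : C 0, cof (identity x))
  (C_po : admits_pushouts cof) :
  admits_pushouts (objectwise cof (K := K)) /\
  forall F : smap (CI_co cof) (CJ_co_po cof), functorial_choice F ->
    exists G : smap (CI_co (objectwise cof (K := K)))
                    (CJ_co_po (objectwise cof (K := K))),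
      smap_comp (CJ_co_po_incl (objectwise cof (K := K))) G = exp_choice K F /\
      functorial_choice G.
Proof.
split=> [d|F F_choice]; last exact: exp_choice_functorial.
have [F F_choice] := pushouts_functorial C_qcat C_po.
have [G [_ G_choice]] := exp_choice_functorial K C_qcat F_choice.
exists (G 0 d).
exact: (congr1 (fun u : smap _ _ => u 0 d) G_choice).
Qed.
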